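(* Let $\mu\colon L^\phi_{\mathcal{F}}(\mathcal{E})\to L^0(\mathcal{F})$ be a homomorphism of $L^0(\mathcal{F})$-modules. Then $\mu$ is $\sigma$-order continuous and order bounded if and only if there exists a (unique) $y\in L^{\phi^\ast}_{\mathcal{F}}(\mathcal{E})$ such that $\mu(x)=\mathbb{E}[xy|\mathcal{F}]$ for all $x\in L^\phi_{\mathcal{F}}(\mathcal{E})$.
   Context: $(\Omega,\mathcal{E},\mathbb{P})$ is a probability space and $\mathcal{F}\subset\mathcal{E}$ a sub-$\sigma$-algebra. Random variables and sets that coincide a.s. are identified; all (in)equalities between $\mathbb{R}\cup\{\pm\infty\}$-valued random variables are in the a.s. sense. $L^0(\mathcal{E})$ and $L^0(\mathcal{F})$ are the spaces of (classes of) real-valued $\mathcal{E}$-, resp. $\mathcal{F}$-measurable random variables, ordered by the a.s. order; $L^0_{++}(\mathcal{F})$ is the set of $\eta\in L^0(\mathcal{F})$ with $\eta>0$ a.s. The conditional expectation is generalized: for $\eta\ge 0$, $\mathbb{E}[\eta|\mathcal{F}]:=\lim_n\mathbb{E}[\eta\wedge n|\mathcal{F}]$ (possibly $+\infty$), and $\mathbb{E}[\eta|\mathcal{F}]:=\mathbb{E}[\eta^+|\mathcal{F}]-\mathbb{E}[\eta^-|\mathcal{F}]$ with $+\infty-\infty=+\infty$. $\phi\colon[0,+\infty)\to[0,+\infty]$ is a Young function: increasing, left-continuous, convex, finite on a neighborhood of $0$, $\phi(0)=0$, $\lim_{x\to+\infty}\phi(x)=+\infty$. Its conjugate Young function is $\phi^\ast(s):=\sup_{r\ge0}\{rs-\phi(r)\}$,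 $s\ge 0$. For a Young function $\psi$, the Orlicz-type module is $L^\psi_{\mathcal{F}}(\mathcal{E}):=\{x\in L^0(\mathcal{E}) : \exists\,\eta\in L^0_{++}(\mathcal{F}),\ \mathbb{E}[\psi(\eta|x|)|\mathcal{F}]\in L^0(\mathcal{F})\}$; it is an $L^0(\mathcal{F})$-submodule and an order ideal of $L^0(\mathcal{E})$. A linear function $\mu\colon\mathcal{X}\to L^0(\mathcal{F})$ on a vector sublattice $\mathcal{X}$ of $L^0(\mathcal{E})$ is order bounded if it maps order bounded sets to order bounded sets; it is $\sigma$-order continuous if $\operatorname{ess.inf}_{n}|\mu(x_n)|=0$ whenever $(x_n)_{n\in\mathbb{N}}$ is a sequence in $\mathcal{X}$ with $x_n\downarrow 0$ a.s. *)

(* Defs.v *)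
From HB Require Import structures.
From mathcomp Require Import all_boot all_order all_algebra.
From mathcomp Require Import all_classical all_reals all_analysis.
From mathcomp Require Import measurable_realfun.

Set Implicit Arguments.
Unset Strict Implicit.
Unset Printing Implicit Defensive.

Import Order.TTheory GRing.Theory Num.Theory.
Import numFieldNormedType.Exports.

Local Open Scope classical_set_scope.
Local Open Scope ring_scope.
Local Open Scope ereal_scope.

(* Random variables are represented by functions, and every identity or
   inequality between them is stated almost everywhere.  A sub-sigma-algebra of
   the ambient one is a set of sets [F] with [sub_sigma_field F]. *)

Definition sub_sigma_field d (T : measurableType d) (F : set (set T)) : Prop :=
  sigma_algebra [set: T] F /\ F `<=` @measurable d T.

Definition measurable_wrt d (T : measurableType d) (F : set (set T))
    d' (U : measurableType d') (f : T -> U) : Prop :=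
  measurable_fun [set: g_sigma_algebraType F] (f : g_sigma_algebraType F -> U).

Definition L0 d (T : measurableType d) (R : realType) : set (T -> R) :=
  [set x | measurable_fun [set: T] x].

Definition L0_sub d (T : measurableType d) (R : realType) (F : set (set T)) :
  set (T -> R) := [set x | measurable_wrt F x].

Definition L0pp_sub d (T : measurableType d) (R : realType)
    (P : probability T R) (F : set (set T)) : set (T -> R) :=
  [set eta | L0_sub F eta /\ {ae P, forall w, (0 < eta w)%R}].

Definition is_condexp d (T : measurableType d) (R : realType)
    (P : probability T R) (F : set (set T)) (f g : T -> \bar R) : Prop :=
  [/\ measurable_wrt F g,
      P.-integrable [set: T] g &
      forall A, F A -> \int[P]_(w in A) g w = \int[P]_(w in A) f w].

(* A version of the conditional expectation of an integrable [f]; one exists by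
   [is_condexp_exists]. *)
Definition condexp d (T : measurableType d) (R : realType)
    (P : probability T R) (F : set (set T)) (f : T -> \bar R) : T -> \bar R :=
  xget (cst 0) [set g | is_condexp P F f g].

Definition gcondexp_ge0 d (T : measurableType d) (R : realType)
    (P : probability T R) (F : set (set T)) (f : T -> \bar R) : T -> \bar R :=
  fun w => limn (fun n : nat => condexp P F (fun v => mine (f v) n%:R%:E) w).

(* The subtraction is the one of [ereal_dual_scope], for which
   +oo - +oo = +oo. *)
Definition gcondexp d (T : measurableType d) (R : realType)
    (P : probability T R) (F : set (set T)) (f : T -> \bar R) : T -> \bar R :=
  fun w => (gcondexp_ge0 P F f^\+ w - gcondexp_ge0 P F f^\- w)%dE.

(* [phi : [0, +oo[ -> [0, +oo]] is encoded by a function on [R] whose values at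
   negative arguments are irrelevant.  In [ereal_scope] 0 * +oo = 0, so the
   convexity inequality is meaningful also where [phi] is infinite. *)
Record young_function (R : realType) (phi : R -> \bar R) : Prop := {
  young_ge0 : forall r : R, (0 <= r)%R -> 0 <= phi r ;
  young_nondecreasing :
    forall r s : R, (0 <= r)%R -> (r <= s)%R -> phi r <= phi s ;
  young_left_continuous :
    forall r : R, (0 < r)%R -> phi s @[s --> r^'-] --> phi r ;
  young_convex : forall r s t : R, (0 <= r)%R -> (0 <= s)%R ->
    (0 <= t <= 1)%R ->
    phi (t * r + (1 - t) * s)%R <= t%:E * phi r + (1 - t)%:E * phi s ;
  young_finite : \forall r \near 0%R^'+, phi r < +oo ;
  young0 : phi 0%R = 0 ;
  young_pinfty : phi r @[r --> +oo%R] --> +oo }.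

Definition young_conjugate (R : realType) (phi : R -> \bar R) : R -> \bar R :=
  fun s => ereal_sup [set (r * s)%:E - phi r | r in `[0%R, +oo[].

(* Almost surely [`|eta w * x w| = eta w * `|x w|], because [eta] is positive;
   the former is nonnegative at every [w]. *)
Definition orlicz_module d (T : measurableType d) (R : realType)
    (P : probability T R) (F : set (set T)) (psi : R -> \bar R) :
    set (T -> R) :=
  [set x | L0 x /\ exists2 eta, L0pp_sub P F eta &
    {ae P, forall w,
       gcondexp P F (fun v => psi `|eta v * x v|%R) w \is a fin_num}].

(* The first clause is well-definedness on almost sure classes. *)
Definition module_hom d (T : measurableType d) (R : realType)
    (P : probability T R) (F : set (set T)) (X : set (T -> R))
    (mu : (T -> R) -> (T -> R)) : Prop :=
  [/\ forall x x', X x -> X x' -> ae_eq P [set: T] x x' ->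
        ae_eq P [set: T] (mu x) (mu x'),
      forall x, X x -> L0_sub F (mu x),
      forall x x', X x -> X x' ->
        ae_eq P [set: T] (mu (x \+ x')%R) (mu x \+ mu x')%R &
      forall eta x, L0_sub F eta -> X x ->
        ae_eq P [set: T] (mu (eta \* x)%R) (eta \* mu x)%R].

Definition order_bounded_in d (T : measurableType d) (R : realType)
    (P : probability T R) (X A : set (T -> R)) : Prop :=
  A `<=` X /\ exists a b, [/\ X a, X b &
    forall x, A x -> {ae P, forall w, (a w <= x w <= b w)%R}].

Definition order_bounded d (T : measurableType d) (R : realType)
    (P : probability T R) (F : set (set T)) (X : set (T -> R))
    (mu : (T -> R) -> (T -> R)) : Prop :=
  forall A, order_bounded_in P X A ->
    order_bounded_in P (L0_sub F) (mu @` A).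

(* The essential infimum of a family: its greatest lower bound for the almost
   sure order on extended real random variables. *)
Definition is_ess_inf d (T : measurableType d) (R : realType)
    (P : probability T R) (I : Type) (f : I -> T -> \bar R) (g : T -> \bar R) :
    Prop :=
  [/\ measurable_fun [set: T] g,
      forall i, {ae P, forall w, g w <= f i w} &
      forall h : T -> \bar R, measurable_fun [set: T] h ->
        (forall i, {ae P, forall w, h w <= f i w}) ->
        {ae P, forall w, h w <= g w}].

Definition sigma_order_continuous d (T : measurableType d) (R : realType)
    (P : probability T R) (X : set (T -> R)) (mu : (T -> R) -> (T -> R)) :
    Prop :=
  forall x_ : nat -> T -> R, (forall n, X (x_ n)) ->
    {ae P, forall w, nonincreasing_seq (x_ ^~ w) /\
                     x_ n w @[n --> \oo] --> 0%R} ->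
    is_ess_inf P (fun n w => `|mu (x_ n) w|%:E) (cst 0).

Definition represents d (T : measurableType d) (R : realType)
    (P : probability T R) (F : set (set T)) (X : set (T -> R))
    (mu : (T -> R) -> (T -> R)) (y : T -> R) : Prop :=
  forall x, X x ->
    ae_eq P [set: T] (EFin \o mu x) (gcondexp P F (EFin \o (x \* y)%R)).

Lemma is_condexp_exists d (T : measurableType d) (R : realType)
    (P : probability T R) (F : set (set T)) (f : T -> \bar R) :
  sub_sigma_field F -> P.-integrable [set: T] f ->
  exists g, is_condexp P F f g.
Proof.
move=> [sF FE] intf.
have gF (A : set T) : <<s F >> A <-> F A.
  by rewrite sigma_algebra_id.
pose G := g_sigma_algebraType F.
pose X : T -> G := fun w => w.
have mX : measurable_fun [set: T] X.
  by move=> _ A mA; rewrite setTI; apply: FE; exact/gF.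
pose X' := [the {mfun T >-> G} of mfun_Sub (mem_set mX : X \in mfun)].
pose Q : probability G R := distribution P X'.
pose nu : {charge set T -> \bar R} := induced_charge intf.
have [nuF nuFE] : exists c : {charge set G -> \bar R},
    forall A, c A = \int[P]_(w in A) f w.
  by unshelve eexists (pushforward nu X : {charge set G -> \bar R}).
have nuQ : nuF `<< Q.
  apply/null_content_dominatesP => A mA QA0.
  have mAT : d.-measurable (A : set T) by apply: FE; exact/gF.
  rewrite nuFE; apply: null_set_integral => //.
  exact: measurable_funS (measurable_int _ intf).
pose g : T -> \bar R := Radon_Nikodym nuF Q.
have intg := Radon_Nikodym_integrable nuQ.
have mg : measurable_wrt F g by exact: measurable_int intg.
have mgT : measurable_fun [set: T] g.
  by move=> _ B mB; apply: FE; apply/gF; exact: mg.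
have Pg : P.-integrable [set: T] g.
  apply/integrableP; split => //.
  have /integrableP[_] := intg; rewrite ge0_integral_distribution//.
  exact: measurableT_comp.
exists g; split => // A FA.
have mA : measurable (A : set G) by exact/gF.
rewrite -nuFE (Radon_Nikodym_integral nuQ mA).
rewrite integral_pushforward//.
exact: (integrableS measurableT (FE _ FA) (@subsetT _ _) Pg).
Qed.

(* Main.v *)
From HB Require Import structures.
Require Import Defs.
From mathcomp Require Import all_boot all_order all_algebra.
From mathcomp Require Import all_classical all_reals all_analysis.
From mathcomp Require Import measurable_realfun.
From mathcomp Require Import ring lra.

(** Generalized conditional expectations are scalarised: a nonnegative [f] has a
    finite one iff [rho * f] is integrable for some [F]-measurable weight
    [0 < rho <= 1], and it is then characterised by the integrals of [h * rho * f]
    over [F]-measurable [h] with values in [0,1].  With Young's inequality this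
    yields the order properties of [x |-> E[x y|F]] by domination.

    Conversely, sigma-order continuity together with order boundedness makes
    [A |-> E[rho * mu 1_A]] countably additive for a suitable weight [rho], and its
    Radon-Nikodym density [y0] represents [rho * mu] on bounded functions, then on
    the whole module by truncation.  If [y0] were not in the conjugate module, on
    some nonnull [F]-measurable set [B] and for every [k] one could pick near
    maximizers [u_k] in the definition of [phi^*(2^-k |y0|)], scaled so that
    [phi(u_k)] has integral at most 1 while
    [E[2^-k u_k |y0| |F] >= 1] on [B]; then [S = sum_k 2^-(k+1) u_k] lies in the
    module, but no weight makes [S * y0] integrable. *)

Set Implicit Arguments.
Unset Strict Implicit.
Unset Printing Implicit Defensive.

Import Order.TTheory GRing.Theory Num.Theory.
Import numFieldNormedType.Exports.

Local Open Scope classical_set_scope.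
Local Open Scope ring_scope.

(** * Integrable real functions on a probability space *)

(** [gcondexp] is a limit of arbitrarily chosen versions, subtracted with a convention for infinite
    values, so neither linearity nor monotonicity can be read off it; a weight turns each statement
    into one about ordinary expectations of integrable functions. Tests on sets suffice because a
    bounded functional that respects midpoints and vanishes on indicators vanishes on all
    [0,1]-valued functions. The same argument carries the density of [mu] from sets to such
    functions. Sigma-order continuity only controls an essential infimum; a.e. convergence is
    recovered from it because a module homomorphism is local on sets of [F], so that sequences can
    be glued along [F]-measurable random indices. In the last step the scale 2^-k sits inside
    [phi^*]: the term 2^-(k+1) u_k |y0| of the pairing is half of u_k (2^-k |y0|), so every term
    contributes at least the same amount over [B] and the partial pairings grow linearly, whereas
    the coefficients 2^-(k+1), of total mass at most 1, let convexity keep the modular of the sums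
    at most 1. *)

Section expectation.
Context d (T : measurableType d) (R : realType) (P : probability T R).
Implicit Types (f g h : T -> R) (c : R).

Notation L1 f := (P.-integrable [set: T] (EFin \o f)).
Notation E f := (Rintegral P [set: T] f).

Lemma L1_measurable f : L1 f -> measurable_fun [set: T] f.
Proof. by move=> /measurable_int /measurable_EFinP. Qed.

Lemma L1_le_ae f g : measurable_fun [set: T] f -> L1 g ->
  {ae P, forall w, `|f w| <= g w} -> L1 f.
Proof.
move=> mf /integrableP[mg gfin] fg; apply/integrableP; split.
  exact/measurable_EFinP.
apply: le_lt_trans gfin; apply: ae_ge0_le_integral => //.
- by apply/measurableT_comp => //; exact/measurable_EFinP.
- exact/measurableT_comp.
- apply: filterS fg => w fg _ /=.
  by rewrite lee_fin (le_trans fg)// ler_norm.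
Qed.

Lemma L1_le f g : measurable_fun [set: T] f -> L1 g ->
  (forall w, `|f w| <= g w) -> L1 f.
Proof. by move=> mf Lg fg; apply: L1_le_ae Lg _ => //; exact: aeW. Qed.

Lemma L1_cst c : L1 (cst c).
Proof. exact: finite_measure_integrable_cst. Qed.

Lemma L1_bounded f c : measurable_fun [set: T] f ->
  (forall w, `|f w| <= c) -> L1 f.
Proof. by move=> mf fc; apply: (L1_le mf (L1_cst c)). Qed.

Lemma L1_D f g : L1 f -> L1 g -> L1 (fun w => f w + g w).
Proof. by move=> Lf Lg; apply: (integrableD measurableT Lf Lg). Qed.

Lemma L1_Z c f : L1 f -> L1 (fun w => c * f w).
Proof. by move=> Lf; apply: (integrableZl measurableT c Lf). Qed.

Lemma L1_norm f : L1 f -> L1 (fun w => `|f w|).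
Proof. exact: integrable_norm. Qed.

Lemma L1_B f g : L1 f -> L1 g -> L1 (fun w => f w - g w).
Proof. by move=> Lf Lg; apply: (integrableB measurableT Lf Lg). Qed.

Lemma L1_mul h f : measurable_fun [set: T] h -> (forall w, `|h w| <= 1) ->
  L1 f -> L1 (fun w => h w * f w).
Proof.
move=> mh h1 Lf; apply: (@L1_le _ (fun w => `|f w|)).
- by apply: measurable_funM => //; exact: L1_measurable.
- exact: L1_norm.
- by move=> w; rewrite normrM ler_piMl.
Qed.

Lemma L1_ae_eq f g : measurable_fun [set: T] g -> ae_eq P [set: T] f g ->
  L1 f -> L1 g.
Proof.
move=> mg fg Lf; apply: (L1_le_ae mg (L1_norm Lf)).
by apply: filterS fg => w ->.
Qed.

(** [Rintegral] is [fine] of the integral, hence 0 on an infinite one; integrability is what makes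
    the two agree. *)
Lemma E_fin f : L1 f -> ((E f)%:E = \int[P]_w (f w)%:E)%E.
Proof.
move=> Lf; rewrite /Rintegral fineK//.
exact: integrable_fin_num.
Qed.

Lemma E_D f g : L1 f -> L1 g -> E (fun w => f w + g w) = E f + E g.
Proof. by move=> Lf Lg; rewrite RintegralD. Qed.

Lemma E_B f g : L1 f -> L1 g -> E (fun w => f w - g w) = E f - E g.
Proof. by move=> Lf Lg; rewrite RintegralB. Qed.

Lemma E_Z c f : L1 f -> E (fun w => c * f w) = c * E f.
Proof. by move=> Lf; rewrite RintegralZl. Qed.

Lemma E_cst c : E (cst c) = c.
Proof. by rewrite Rintegral_cst//; have /= -> := probability_setT P; rewrite mulr1. Qed.

Lemma E_ae_eq f g : measurable_fun [set: T] f -> measurable_fun [set: T] g ->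
  ae_eq P [set: T] f g -> E f = E g.
Proof.
move=> mf mg fg; rewrite /Rintegral; congr fine.
apply: ae_eq_integral => //; [exact/measurable_EFinP|exact/measurable_EFinP|].
by apply: filterS fg => w /(_ I) ->.
Qed.

Lemma E_ge0 f : (forall w, 0 <= f w) -> 0 <= E f.
Proof. by move=> f0; apply: Rintegral_ge0 => w _. Qed.

Lemma E_le f g : L1 f -> L1 g -> (forall w, f w <= g w) -> E f <= E g.
Proof. by move=> Lf Lg fg; apply: le_Rintegral. Qed.

Lemma E_le_ae f g : L1 f -> L1 g -> {ae P, forall w, f w <= g w} -> E f <= E g.
Proof.
move=> Lf Lg fg; have mf := L1_measurable Lf; have mg := L1_measurable Lg.
(* [E_le] asks for an inequality everywhere, so [g] is replaced by its a.e. equal version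
   [max f g]. *)
have mm : measurable_fun [set: T] (fun w => Num.max (f w) (g w)).
  exact: measurable_maxr.
have e : ae_eq P [set: T] g (fun w => Num.max (f w) (g w)).
  by apply: filterS fg => w fg _; rewrite /Num.max; case: ltgtP fg.
rewrite (E_ae_eq mg mm e); apply: E_le => //; last by move=> w; rewrite le_max lexx.
exact: L1_ae_eq e Lg.
Qed.

Lemma E_norm f : L1 f -> `|E f| <= E (fun w => `|f w|).
Proof. by move=> Lf; exact: le_normr_Rintegral. Qed.

Lemma E_eq0 f : L1 f -> (forall w, 0 <= f w) -> E f <= 0 ->
  ae_eq P [set: T] f (cst 0).
Proof.
move=> Lf f0 Ef; have mf := L1_measurable Lf.
have E0 : E f = 0 by apply/eqP; rewrite eq_le Ef E_ge0.
have : ae_eq P [set: T] (EFin \o f) (cst 0%E).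
  apply/(ae_eq_integral_abs P measurableT); first exact/measurable_EFinP.
  under eq_integral do rewrite gee0_abs ?lee_fin//.
  by rewrite -E_fin// E0.
by apply: filterS => w /(_ I) /= [].
Qed.

Lemma E_dominated (f_ : nat -> T -> R) f g :
  (forall n, measurable_fun [set: T] (f_ n)) -> measurable_fun [set: T] f ->
  {ae P, forall w, f_ n w @[n --> \oo] --> f w} ->
  L1 g -> (forall n, {ae P, forall w, `|f_ n w| <= g w}) ->
  L1 f /\ E (f_ n) @[n --> \oo] --> E f.
Proof.
move=> mf_ mf cf Lg dom.
have [Lf _ cE] : [/\ L1 f,
    [sequence \int[P]_w `|(f_ n w)%:E - (f w)%:E|]_n @ \oo --> 0%E &
    [sequence \int[P]_w (f_ n w)%:E]_n @ \oo --> \int[P]_w (f w)%:E]%E.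
  apply: (@dominated_convergence _ _ _ P _ measurableT _ _ (EFin \o g)) => //.
  - by move=> n; exact/measurable_EFinP.
  - exact/measurable_EFinP.
  - apply: filterS cf => w cf _ /=.
    by apply: cvg_EFin => //; exact: nearW.
  - have : {ae P, forall w n, `|f_ n w| <= g w} by exact/ae_foralln.
    by apply: filterS => w dw n _ /=; rewrite lee_fin.
split => //; apply: fine_cvg; rewrite -/(E f).
by move: cE; rewrite -(E_fin Lf).
Qed.

(** Monotone convergence; the uniform bound [c] on the real expectations is what keeps the integral
    of the limit finite. *)
Lemma L1_nondecreasing (f_ : nat -> T -> R) f c :
  (forall n, measurable_fun [set: T] (f_ n)) -> measurable_fun [set: T] f ->
  (forall n w, 0 <= f_ n w) -> (forall w, nondecreasing_seq (f_ ^~ w)) ->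
  (forall w, f_ n w @[n --> \oo] --> f w) ->
  (forall n, L1 (f_ n)) -> (forall n, E (f_ n) <= c) -> L1 f.
Proof.
move=> mf_ mf f0 nd cf Lf Efc.
have fge0 w : 0 <= f w.
  rewrite -(cvg_lim _ (cf w))//; apply: le_trans (f0 0%N w) _.
  by apply: nondecreasing_cvgn_le => //; apply/cvg_ex; exists (f w).
apply/integrableP; split; first exact/measurable_EFinP.
under eq_integral do rewrite gee0_abs ?lee_fin//.
apply: (@le_lt_trans _ _ c%:E); last exact: ltry.
have := @cvg_monotone_convergence _ _ _ P _ measurableT
  (fun n => EFin \o f_ n).
move=> /(_ (fun n => (measurable_EFinP _ _).2 (mf_ n))).
move=> /(_ (fun n w _ => f0 n w)) /(_ (fun w _ m n mn => nd w m n mn)).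
have e w : limn (fun n => (f_ n w)%:E) = (f w)%:E.
  by apply/cvg_lim => //; apply: cvg_EFin; [exact: nearW|exact: cf].
under [X in _ --> X -> _]eq_integral do rewrite /= e.
move=> /cvg_lim <- //; apply: lime_le.
  apply: ereal_nondecreasing_is_cvgn => m n mn.
  apply: ge0_le_integral => //=.
  - by move=> w _; rewrite lee_fin.
  - exact/measurable_EFinP.
  - exact/measurable_EFinP.
  - by move=> w _; rewrite lee_fin nd.
by apply: nearW => n; rewrite -E_fin// lee_fin.
Qed.

End expectation.

(** * Conditional expectations tested on [0,1]-valued functions *)

Section comparison_sets.
Context d (T : measurableType d) (R : realType) (f g : T -> R).
Hypotheses (mf : measurable_fun [set: T] f) (mg : measurable_fun [set: T] g).

Lemma measurable_ltr_set : measurable [set w | f w < g w].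
Proof.
have := measurable_fun_ltr mf mg measurableT (I : measurable [set true]).
by rewrite setTI; congr measurable; apply/seteqP; split => w /= ->.
Qed.

Lemma measurable_ler_set : measurable [set w | f w <= g w].
Proof.
have := measurable_fun_ler mf mg measurableT (I : measurable [set true]).
by rewrite setTI; congr measurable; apply/seteqP; split => w /= ->.
Qed.

End comparison_sets.

Section halving.
Context d (T : measurableType d) (R : realType).

(** Stated over any measurable type, since [halving_vanish] is used both on [T] and on [T] with the
    sigma-algebra [F]. *)
Definition unit_valued (z : T -> R) :=
  measurable_fun [set: T] z /\ forall w, 0 <= z w <= 1.

(* Every [0,1]-valued [z] is the average of the indicator of [1/2 <= z] and of
   another [0,1]-valued function, so that the bound [c] can be halved. *)
Lemma halving_vanish (D : (T -> R) -> R) (c : R) :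
  (forall A, measurable A -> D \1_A = 0) ->
  (forall z z', unit_valued z -> unit_valued z' ->
     D (fun w => (z w + z' w) / 2) = (D z + D z') / 2) ->
  (forall z, unit_valued z -> `|D z| <= c) ->
  forall z, unit_valued z -> D z = 0.
Proof.
move=> D1 Dmid Dc.
have half c' : (forall z, unit_valued z -> `|D z| <= c') ->
    forall z, unit_valued z -> `|D z| <= c' / 2.
  move=> Dc' z [mz z01]; pose A := [set w | 1 / 2 <= z w].
  have mA : measurable A.
    exact: (@measurable_ler_set _ _ _ (cst (1 / 2)) z).
  pose z' : T -> R := fun w => 2 * z w - \1_A w.
  have uz' : unit_valued z'.
    split.
      apply: measurable_funB; first exact: measurable_funM.
      exact: measurable_indic.
    move=> w; have := z01 w; rewrite /z' indicE.
    case: (boolP (w \in A)); rewrite ?inE ?notin_setE /A /=; first lra.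
    by move=> /negP; rewrite -ltNge; lra.
  have u1 : unit_valued (\1_A : T -> R).
    split; first exact: measurable_indic.
    by move=> w; rewrite indicE; case: (_ \in _); rewrite ?lexx ?ler01.
  have -> : z = (fun w => (\1_A w + z' w) / 2).
    by apply/funext => w; rewrite /z' addrC subrK; lra.
  rewrite Dmid// D1// add0r normrM ler_pM//; first exact: Dc'.
  by rewrite ger0_norm.
have iterh n : forall z, unit_valued z -> `|D z| <= c / 2 ^+ n.
  elim: n => [z uz|n IH]; first by rewrite expr0 divr1 Dc.
  by rewrite exprSr invfM mulrA; exact: half.
move=> z uz; apply/eqP; rewrite -normr_le0.
have c0 : 0 <= c by apply: le_trans (Dc z uz).
apply/ler_addgt0Pl => e e0; rewrite addr0.
have cvg0 : c * 2^-1 ^+ n @[n --> \oo] --> 0.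
  rewrite -(mulr0 c); apply: cvgMr; apply: cvg_expr.
  by rewrite ger0_norm ?invr_ge0// invf_lt1// ltr1n.
have [n _ /(_ n (leqnn n)) /=] := (cvgr0Pnorm_le _).1 cvg0 _ e0.
rewrite ger0_norm ?mulr_ge0 ?exprn_ge0 ?invr_ge0// exprVn => h.
exact: le_trans (iterh n z uz) h.
Qed.

End halving.

Section measurable_wrt.
Context d (T : measurableType d) (R : realType) (P : probability T R).
Variables (F : set (set T)) (sF : sub_sigma_field F).

Notation L1 f := (P.-integrable [set: T] (EFin \o f)).
Notation E f := (Rintegral P [set: T] f).

Lemma measurable_sub_sigma (A : set T) :
  measurable (A : set (g_sigma_algebraType F)) <-> F A.
Proof. by rewrite /measurable /= sigma_algebra_id//; exact: sF.1. Qed.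

Lemma measurable_wrtW d' (U : measurableType d') (f : T -> U) :
  measurable_wrt F f -> measurable_fun [set: T] f.
Proof.
by move=> mf _ B mB; apply: sF.2; apply/measurable_sub_sigma; exact: mf.
Qed.

Lemma sub_sigma_measurable (A : set T) : F A -> measurable A.
Proof. exact: sF.2. Qed.

Lemma measurable_wrt_indic (A : set T) : F A -> measurable_wrt F (\1_A : T -> R).
Proof.
by move=> /measurable_sub_sigma mA; exact: (@measurable_indic _ _ R _ _ mA).
Qed.

Definition unit_wrt (h : T -> R) := measurable_wrt F h /\ forall w, 0 <= h w <= 1.

Lemma unit_wrt_indic (A : set T) : F A -> unit_wrt \1_A.
Proof.
move=> FA; split; first exact: measurable_wrt_indic.
by move=> w; rewrite indicE; case: (_ \in _); rewrite ?lexx ?ler01.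
Qed.

Lemma unit_wrt_measurable h : unit_wrt h -> measurable_fun [set: T] h.
Proof. by case=> /measurable_wrtW. Qed.

Lemma unit_wrt_norm h w : unit_wrt h -> `|h w| <= 1.
Proof. by case=> _ /(_ w) /andP[h0 h1]; rewrite ger0_norm. Qed.

Lemma unit_wrtM h h' : unit_wrt h -> unit_wrt h' -> unit_wrt (fun w => h w * h' w).
Proof.
move=> [mh h01] [mh' h01']; split; first exact: measurable_funM.
move=> w; have /andP[? ?] := h01 w; have /andP[? ?] := h01' w.
by rewrite mulr_ge0//= mulr_ile1.
Qed.

Lemma L1_unit_mul h f : unit_wrt h -> L1 f -> L1 (fun w => h w * f w).
Proof.
move=> uh; apply: L1_mul; first exact: unit_wrt_measurable.
by move=> w; exact: unit_wrt_norm.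
Qed.

(* Testing on sets amounts to testing on [0,1]-valued functions. *)
Lemma E_unit_eq f g : L1 f -> L1 g ->
  (forall A, F A -> E (fun w => \1_A w * f w) = E (fun w => \1_A w * g w)) ->
  forall h, unit_wrt h -> E (fun w => h w * f w) = E (fun w => h w * g w).
Proof.
move=> Lf Lg fg h uh.
pose D (z : g_sigma_algebraType F -> R) :=
  E (fun w => z w * f w) - E (fun w => z w * g w).
apply/eqP; rewrite -subr_eq0; apply/eqP; apply: (@halving_vanish _ _ _ D
  (E (fun w => `|f w|) + E (fun w => `|g w|))) => //.
- by move=> A /measurable_sub_sigma FA; rewrite /D fg// subrr.
- move=> z z' uz uz'; rewrite /D.
  have split1 u : L1 u -> E (fun w => (z w + z' w) / 2 * u w) =
      (E (fun w => z w * u w) + E (fun w => z' w * u w)) / 2.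
    move=> Lu; rewrite -E_D; [|exact: L1_unit_mul..].
    rewrite mulrC -E_Z; last by apply: L1_D; exact: L1_unit_mul.
    by congr Rintegral; apply/funext => w; lra.
  by rewrite !split1//; lra.
- move=> z uz; rewrite /D; apply: le_trans (ler_normB _ _) _.
  have bnd u : L1 u -> `|E (fun w => z w * u w)| <= E (fun w => `|u w|).
    move=> Lu; apply: le_trans (E_norm (L1_unit_mul uz Lu)) _.
    apply: E_le; [exact/L1_norm/L1_unit_mul|exact: L1_norm|].
    by move=> w; rewrite normrM ler_piMl//; exact: unit_wrt_norm.
  by rewrite lerD// bnd.
Qed.

(** The set [[g' < g]] lies in [F], so its indicator is an admissible test: it leaves a nonnegative
    function with nonpositive expectation. *)
Lemma wrt_le_ae g g' : measurable_wrt F g -> measurable_wrt F g' ->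
  L1 g -> L1 g' ->
  (forall h, unit_wrt h -> E (fun w => h w * g w) <= E (fun w => h w * g' w)) ->
  {ae P, forall w, g w <= g' w}.
Proof.
move=> mg mg' Lg Lg' gg'; pose A := [set w | g' w < g w].
have FA : F A.
  by apply/measurable_sub_sigma; exact: measurable_ltr_set mg' mg.
have uA := unit_wrt_indic FA.
have := gg' _ uA.
rewrite -subr_le0 -E_B; [|exact: L1_unit_mul..].
move=> le0; have := E_eq0 (L1_B (L1_unit_mul uA Lg) (L1_unit_mul uA Lg')) _ le0.
have nn w : 0 <= \1_A w * g w - \1_A w * g' w.
  rewrite indicE; case: (boolP (w \in A)); rewrite ?inE /A /=; lra.
move=> /(_ nn); apply: filterS => w /(_ I) /=; rewrite indicE.
by case: (boolP (w \in A)); rewrite ?inE ?notin_setE /A /=; lra.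
Qed.

Lemma wrt_eq_ae g g' : measurable_wrt F g -> measurable_wrt F g' ->
  L1 g -> L1 g' ->
  (forall h, unit_wrt h -> E (fun w => h w * g w) = E (fun w => h w * g' w)) ->
  ae_eq P [set: T] g g'.
Proof.
move=> mg mg' Lg Lg' gg'.
have h1 : {ae P, forall w, g w <= g' w}.
  by apply: wrt_le_ae => // h uh; rewrite gg'.
have h2 : {ae P, forall w, g' w <= g w}.
  by apply: wrt_le_ae => // h uh; rewrite gg'.
by apply: filterS2 h1 h2 => w h1 h2 _; apply/eqP; rewrite eq_le h1 h2.
Qed.

(** [condexp] picks some extended real version; being integrable, that version is a.e. finite and
    its [fine] part is a version with real values everywhere. The defining identity on sets of [F]
    then passes to [0,1]-valued tests. *)
Lemma condexp_real f : L1 f -> exists g : T -> R,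
  [/\ measurable_wrt F g, L1 g,
      forall h, unit_wrt h -> E (fun w => h w * g w) = E (fun w => h w * f w) &
      ae_eq P [set: T] (condexp P F (EFin \o f)) (EFin \o g)].
Proof.
move=> Lf; have [g0 g0P] := is_condexp_exists sF Lf.
have : is_condexp P F (EFin \o f) (condexp P F (EFin \o f)).
  by apply: (@xgetPex _ (cst 0%E) [set g | is_condexp P F (EFin \o f) g]); exists g0.
move: (condexp _ _ _) => c [mc Lc cE]; pose g w := fine (c w).
have mg : measurable_wrt F g by exact: measurableT_comp.
have cg : ae_eq P [set: T] c (EFin \o g).
  have := integrable_ae measurableT Lc.
  by apply: filterS => w cfin _ /=; rewrite /g fineK// cfin.
have Lg : L1 g.
  apply/integrableP; split; first exact/measurable_EFinP/measurable_wrtW.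
  have /integrableP[_] := Lc; apply: le_lt_trans; apply: ae_ge0_le_integral => //.
  - by apply: measurableT_comp => //; exact/measurable_EFinP/measurable_wrtW.
  - by apply: measurableT_comp => //; exact: measurable_wrtW.
  - by apply: filterS cg => w /(_ I) -> _.
exists g; split => //; apply: E_unit_eq => // A FA.
have ind (u : T -> R) : (fun w => \1_A w * u w) = u \_ A.
  apply/funext => w; rewrite indicE patchE.
  by case: (_ \in _); rewrite ?mul1r ?mul0r.
rewrite !ind -!Rintegral_mkcond /Rintegral.
have mA := sub_sigma_measurable FA.
have := cE A FA; rewrite /comp => <-; congr fine; apply: ae_eq_integral => //.
- exact/measurable_EFinP/measurable_funTS/measurable_wrtW.
- by apply/measurable_funTS/measurable_wrtW.
- by apply: filterS cg => w /(_ I) ->.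
Qed.

End measurable_wrt.

(** * Generalized conditional expectations *)

Section generalized_condexp_ge0.
Local Open Scope ereal_scope.
Context d (T : measurableType d) (R : realType) (P : probability T R).

Notation L1 f := (P.-integrable [set: T] (EFin \o f)).
Notation E f := (Rintegral P [set: T] f).

Lemma monotone_integral_cvg (f_ : nat -> T -> \bar R) (f : T -> \bar R) :
  (forall n, measurable_fun [set: T] (f_ n)) -> (forall n w, 0 <= f_ n w) ->
  (forall w, {homo f_ ^~ w : m n / (m <= n)%N >-> m <= n}) ->
  (forall w, f_ n w @[n --> \oo] --> f w) ->
  \int[P]_w f_ n w @[n --> \oo] --> \int[P]_w f w.
Proof.
move=> mf f0 nd cf.
have := @cvg_monotone_convergence _ _ _ P _ measurableT f_ mf
  (fun n w _ => f0 n w) (fun w _ => nd w).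
by under [X in _ --> X -> _]eq_integral do rewrite (cvg_lim _ (cf _))//.
Qed.

Lemma mine_nat_cvg (x : \bar R) : 0 <= x ->
  mine x n%:R%:E @[n --> \oo] --> x.
Proof.
case: x => [r r0||//].
- apply: cvg_near_cst; near=> n; apply/min_idPl; rewrite lee_fin.
  by near: n; exact: nbhs_infty_ger.
- move=> _; rewrite (_ : (fun n => _) = (fun n => (n%:R : R)%:E)).
    by apply/cvgeryP; exact: cvgr_idn.
  by apply/funext => n; apply/min_idPr; rewrite leey.
Unshelve. all: by end_near. Qed.

Variables (F : set (set T)) (sF : sub_sigma_field F).

(** Truncations are bounded, so each has a real conditional expectation, and monotone convergence is
    applied to both sides of the tested identities. The result is a version that is nonnegative and
    [F]-measurable everywhere. *)
Lemma gcondexp_ge0_version (f : T -> \bar R) :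
  measurable_fun [set: T] f -> (forall w, 0 <= f w) ->
  exists g : T -> \bar R,
    [/\ measurable_wrt F g, forall w, 0 <= g w,
        ae_eq P [set: T] (gcondexp_ge0 P F f) g &
        forall h, unit_wrt F h ->
          \int[P]_w ((h w)%:E * g w) = \int[P]_w ((h w)%:E * f w)].
Proof.
move=> mf f0; pose f_ n w := fine (mine (f w) (n%:R%:E)).
have min0 n w : 0 <= mine (f w) n%:R%:E by rewrite le_min f0 lee_fin ler0n.
have f_E n w : (f_ n w)%:E = mine (f w) n%:R%:E.
  rewrite fineK// ge0_fin_numE//.
  by apply: le_lt_trans (ltry n%:R); rewrite ge_min lexx orbT.
have f_ge0 n w : (0 <= f_ n w)%R by rewrite -lee_fin f_E.
have mf_ n : measurable_fun [set: T] (f_ n).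
  by apply: measurableT_comp => //; exact: measurable_mine.
have Lf_ n : L1 (f_ n).
  apply: (@L1_bounded _ _ _ _ _ n%:R) => // w.
  by rewrite ger0_norm// -lee_fin f_E ge_min lexx orbT.
have ndf m n w : (m <= n)%N -> (f_ m w <= f_ n w)%R.
  by move=> mn; rewrite -lee_fin !f_E le_min2// lee_fin ler_nat.
have /choice [c_ cP] := fun n => condexp_real sF (Lf_ n).
have c0 : {ae P, forall w n, (0 <= c_ n w)%R}.
  apply/ae_foralln => n; have [mc Lc cE _] := cP n.
  have L0 : L1 (cst 0%R : T -> R) by exact: L1_cst.
  have m0 : measurable_wrt F (cst 0%R : T -> R) by exact: measurable_cst.
  apply: (wrt_le_ae sF m0 mc L0 Lc) => h uh; rewrite cE//; apply: E_le.
  - exact: (L1_unit_mul sF uh L0).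
  - exact: (L1_unit_mul sF uh (Lf_ n)).
  - by move=> w; rewrite ler_wpM2l//; case/andP: (uh.2 w).
have cnd : {ae P, forall w n, (c_ n w <= c_ n.+1 w)%R}.
  apply/ae_foralln => n; have [mc Lc cE _] := cP n.
  have [mc' Lc' cE' _] := cP n.+1.
  apply: (wrt_le_ae sF) => // h uh; rewrite cE// cE'//; apply: E_le.
  - exact: (L1_unit_mul sF uh (Lf_ n)).
  - exact: (L1_unit_mul sF uh (Lf_ n.+1)).
  - by move=> w; rewrite ler_wpM2l ?ndf//; case/andP: (uh.2 w).
(* The [c_ n] are nonnegative and nondecreasing only a.e.; their running maxima, started at 0, are
   so everywhere and coincide with them a.e. *)
pose g_ := fix g_ n w := if n is n'.+1 then Num.max (g_ n' w) (c_ n w)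
  else Num.max 0%R (c_ 0%N w).
have mg_ n : measurable_wrt F (g_ n).
  elim: n => [|n IH]; have [mc _ _ _] := cP 0%N.
    by apply: measurable_maxr => //; exact: measurable_cst.
  by have [mc' _ _ _] := cP n.+1; exact: (measurable_maxr IH mc').
have g_ge0 n w : (0 <= g_ n w)%R.
  by elim: n => [|n IH] /=; rewrite le_max ?lexx// IH.
have ndg w : {homo g_ ^~ w : m n / (m <= n)%N >-> (m <= n)%R}.
  by apply/nondecreasing_seqP => n /=; rewrite le_max lexx.
have gc : {ae P, forall w n, g_ n w = c_ n w}.
  apply: filterS2 c0 cnd => w c0 cnd; elim=> [|n IH] /=.
    exact/max_idPr.
  by rewrite IH; exact/max_idPr.
have Lg_ n : L1 (g_ n).
  have [_ Lc _ _] := cP n; apply: L1_ae_eq Lc; first exact: measurable_wrtW (mg_ n).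
  by apply: filterS gc => w ->.
have gE n h : unit_wrt F h -> (E (fun w => h w * g_ n w) = E (fun w => h w * f_ n w))%R.
  move=> uh; have [mc Lc cE _] := cP n; rewrite -cE//; apply: E_ae_eq.
  - exact: (L1_measurable (L1_unit_mul sF uh (Lg_ n))).
  - exact: (L1_measurable (L1_unit_mul sF uh Lc)).
  - by apply: filterS gc => w ->.
pose g w : \bar R := limn (fun n => (g_ n w)%:E).
have cg w : (g_ n w)%:E @[n --> \oo] --> g w.
  by apply: ereal_nondecreasing_is_cvgn => m n mn; rewrite lee_fin ndg.
have g0 w : 0 <= g w.
  by apply: lime_ge; [exact: cg|apply: nearW => n; rewrite lee_fin].
exists g; split => //.
- apply: (@emeasurable_fun_cvg _ (g_sigma_algebraType F) _ _ (fun n w => (g_ n w)%:E)) => //.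
  by move=> n; apply/measurable_EFinP; exact: mg_.
- have cc : {ae P, forall w n, condexp P F (fun v => mine (f v) n%:R%:E) w = (c_ n w)%:E}.
    apply/ae_foralln => n; have [_ _ _] := cP n.
    rewrite (_ : EFin \o f_ n = (fun v => mine (f v) n%:R%:E)); last first.
      by apply/funext => w; rewrite /= f_E.
    by apply: filterS => w ->.
  apply: filterS2 gc cc => w gc cc _; rewrite /gcondexp_ge0 /g.
  by congr (limn _); apply/funext => n; rewrite cc gc.
- move=> h uh; have h0 w : 0 <= (h w)%:E by rewrite lee_fin; case/andP: (uh.2 w).
  have mh := unit_wrt_measurable sF uh.
  have l : \int[P]_w ((h w)%:E * (g_ n w)%:E) @[n --> \oo] -->
      \int[P]_w ((h w)%:E * g w).
    apply: monotone_integral_cvg.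
    + move=> n; apply: emeasurable_funM; apply/measurable_EFinP => //.
      exact: (measurable_wrtW sF (mg_ n)).
    + by move=> n w; rewrite mule_ge0// lee_fin.
    + by move=> w m n mn; rewrite lee_wpmul2l// lee_fin ndg.
    + by move=> w; exact: cvgeZl (cg w).
  have r : \int[P]_w ((h w)%:E * (f_ n w)%:E) @[n --> \oo] -->
      \int[P]_w ((h w)%:E * f w).
    apply: monotone_integral_cvg.
    + by move=> n; apply: emeasurable_funM; apply/measurable_EFinP.
    + by move=> n w; rewrite mule_ge0// lee_fin.
    + by move=> w m n mn; rewrite lee_wpmul2l// lee_fin ndf.
    + move=> w; apply: cvgeZl => //; under eq_fun do rewrite f_E.
      exact: mine_nat_cvg.
  rewrite -(cvg_lim _ l)// -(cvg_lim _ r)//; congr (limn _); apply/funext => n.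
  under eq_integral do rewrite -EFinM.
  under [RHS]eq_integral do rewrite -EFinM.
  rewrite -(E_fin (L1_unit_mul sF uh (Lg_ n))).
  by rewrite -(E_fin (L1_unit_mul sF uh (Lf_ n))) gE.
Qed.

End generalized_condexp_ge0.

(** * Weights that make conditional expectations integrable *)

Section weights.
Context d (T : measurableType d) (R : realType) (P : probability T R).
Variables (F : set (set T)) (sF : sub_sigma_field F).

Notation L1 f := (P.-integrable [set: T] (EFin \o f)).
Notation E f := (Rintegral P [set: T] f).

(** The range ]0,1] makes a weight an admissible test function itself, keeps integrability under
    multiplication, and allows it to be cancelled at every point. *)
Definition weight (rho : T -> R) :=
  measurable_wrt F rho /\ forall w, 0 < rho w <= 1.

Lemma weight_gt0 rho w : weight rho -> 0 < rho w.
Proof. by case=> _ /(_ w) /andP[]. Qed.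

Lemma weight_unit rho : weight rho -> unit_wrt F rho.
Proof. by move=> [m r]; split => // w; have := r w; lra. Qed.

Lemma weightM rho rho' : weight rho -> weight rho' ->
  weight (fun w => rho w * rho' w).
Proof.
move=> wr wr'; split; first by apply: measurable_funM; [exact: wr.1|exact: wr'.1].
move=> w; have := wr.2 w; have := wr'.2 w => /andP[? ?] /andP[? ?].
by rewrite mulr_gt0//= mulr_ile1// ltW.
Qed.

Lemma weight1 : weight (cst 1).
Proof. by split; [exact: measurable_cst|move=> w /=; rewrite ltr01 lexx]. Qed.

(** The standard weight attached to an [F]-measurable [c]: it brings [c] into [-1,1], and the 1 in
    the denominator keeps it defined where [c] vanishes. *)
Definition damping (c : T -> R) : T -> R := fun w => (1 + `|c w|)^-1.

Lemma weight_damping c : measurable_wrt F c -> weight (damping c).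
Proof.
move=> mc; have c1 w : 1 <= 1 + `|c w| by rewrite lerDl.
have c0 w : 0 < 1 + `|c w| by exact: lt_le_trans (c1 w).
split; last by move=> w; rewrite /damping invr_gt0 c0 /= invf_le1// c1.
apply: (@measurableT_comp _ _ _ _ _ _ (fun x : R => (1 + `|x|)^-1)) => //.
apply: continuous_measurable_fun => x.
apply: cvgV; first by rewrite gt_eqF// ltr_pwDl.
by apply: cvgD; [exact: cvg_cst|apply: cvg_norm; exact: cvg_id].
Qed.

Lemma damping_le1 c w : `|damping c w * c w| <= 1.
Proof.
rewrite normrM /damping ger0_norm ?invr_ge0 ?addr_ge0//.
by rewrite mulrC ler_pdivrMr ?mul1r ?lerDr// ltr_pwDl.
Qed.

(** The subtracted term is the conditional expectation of the zero negative part; testing its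
    version against the constant 1 shows that it vanishes a.e. *)
Lemma gcondexp_of_ge0 (f : T -> \bar R) :
  measurable_fun [set: T] f -> (forall w, 0 <= f w)%E ->
  ae_eq P [set: T] (gcondexp P F f) (gcondexp_ge0 P F f).
Proof.
move=> mf f0.
have fp : (f^\+ = f)%E by apply/funext => w; rewrite funeposE; exact/max_idPl.
have fn : (f^\- = cst 0)%E.
  by apply/funext => w; rewrite funenegE; apply/max_idPr; rewrite leeNl oppe0.
have [g [mg g0 eg intg]] := gcondexp_ge0_version P sF
  (measurable_cst 0%E : measurable_fun _ (cst 0%E : T -> \bar R)) (fun=> lexx _).
have g00 : ae_eq P [set: T] g (cst 0%E).
  apply/(ae_eq_integral_abs P measurableT); first exact: measurable_wrtW mg.
  transitivity (\int[P]_w ((cst 1%R w)%:E * g w))%E.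
    by apply: eq_integral => w _; rewrite gee0_abs// mul1e.
  by rewrite intg; [apply: integral0_eq => w _; rewrite mule0|
    exact: (weight_unit weight1)].
apply: filterS2 eg g00 => w /(_ I) eg /(_ I) g00 _.
by rewrite /gcondexp fp fn eg g00 /=; case: (gcondexp_ge0 P F f w) => //= r; rewrite oppr0 addr0.
Qed.

(** If the conditional expectation is finite, its own damping is a weight under which it is at most
    1. Conversely, once multiplied by [rho] it is integrable, hence a.e. finite, and [rho > 0]
    transfers this to the conditional expectation. *)
Lemma gcondexp_fin_numP (f : T -> \bar R) :
  measurable_fun [set: T] f -> (forall w, 0 <= f w)%E ->
  {ae P, forall w, gcondexp P F f w \is a fin_num} <->
  exists2 rho, weight rho & (\int[P]_w ((rho w)%:E * f w) < +oo)%E.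
Proof.
move=> mf f0; have [g [mg g0 eg intg]] := gcondexp_ge0_version P sF mf f0.
have eG : ae_eq P [set: T] (gcondexp P F f) g.
  by apply: filterS2 (gcondexp_of_ge0 mf f0) eg => w e1 e2 _; rewrite e1// e2.
split=> [fin|[rho wr fin]].
  pose c w := fine (g w); have mc : measurable_wrt F c by exact: measurableT_comp.
  have wc := weight_damping mc; exists (damping c) => //.
  rewrite -intg; last exact: weight_unit.
  apply: (@le_lt_trans _ _ (\int[P]_w (cst 1 w))%E); last first.
    by rewrite integral_cst// mul1e; have /= -> := probability_setT P; exact: ltry.
  have mwc : measurable_fun [set: T] (damping c).
    exact: unit_wrt_measurable sF _ (weight_unit wc).
  apply: ae_ge0_le_integral => //.
  - by move=> w _; rewrite mule_ge0// lee_fin ltW// weight_gt0.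
  - apply: emeasurable_funM; first exact/measurable_EFinP.
    exact: measurable_wrtW mg.
  - apply: filterS2 eG fin => w /(_ I) -> /fineK gw _.
    rewrite -gw -EFinM lee_fin; apply: le_trans (damping_le1 c w).
    exact: ler_norm.
have mrho : measurable_fun [set: T] rho.
  exact: unit_wrt_measurable sF _ (weight_unit wr).
have : P.-integrable [set: T] (fun w => (rho w)%:E * g w)%E.
  apply/integrableP; split.
    apply: emeasurable_funM; first exact/measurable_EFinP.
    exact: measurable_wrtW mg.
  under eq_integral do rewrite gee0_abs ?mule_ge0 ?lee_fin ?(ltW (weight_gt0 _ wr))//.
  by rewrite intg//; exact: weight_unit.
move=> /(integrable_ae measurableT); apply: filterS2 eG => w /(_ I) -> /(_ I).
have := g0 w; have := weight_gt0 w wr; case: (g w) => // r0 _.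
by rewrite gt0_muley.
Qed.

Lemma gcondexp_ge0_weighted (f rho : T -> R) :
  measurable_fun [set: T] f -> (forall w, 0 <= f w) -> weight rho ->
  L1 (fun w => rho w * f w) ->
  exists g : T -> R, [/\ measurable_wrt F g, L1 (fun w => rho w * g w),
    forall h, unit_wrt F h ->
      E (fun w => h w * (rho w * g w)) = E (fun w => h w * (rho w * f w)) &
    ae_eq P [set: T] (gcondexp_ge0 P F (EFin \o f)) (EFin \o g)].
Proof.
move=> mf f0 wr Lf.
have mEf : measurable_fun [set: T] (EFin \o f) by exact/measurable_EFinP.
have Ef0 w : (0 <= (EFin \o f) w)%E by rewrite lee_fin.
have [G [mG G0 eG intG]] := gcondexp_ge0_version P sF mEf Ef0.
have ur := weight_unit wr.
have r0 w := weight_gt0 w wr.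
have mrho := unit_wrt_measurable sF ur.
pose g w := fine (G w).
have mg : measurable_wrt F g by exact: measurableT_comp.
have Gfin : ae_eq P [set: T] G (EFin \o g).
  have LG : P.-integrable [set: T] (fun w => (rho w)%:E * G w)%E.
    apply/integrableP; split.
      apply: emeasurable_funM; first exact/measurable_EFinP.
      exact: measurable_wrtW mG.
    under eq_integral do rewrite gee0_abs ?mule_ge0 ?lee_fin ?(ltW (r0 _))//.
    rewrite intG//; have /integrableP[_] := Lf.
    by under eq_integral do rewrite /= ger0_norm ?mulr_ge0 ?(ltW (r0 _))// EFinM.
  have := integrable_ae measurableT LG; apply: filterS => w /(_ I) fin _.
  rewrite /= /g fineK//; move: fin; have := G0 w; have := r0 w.
  by case: (G w) => // r0' _; rewrite gt0_muley.
have g0 w : 0 <= g w by rewrite fine_ge0.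
have int_eq h : unit_wrt F h ->
    (\int[P]_w (h w * (rho w * g w))%:E = \int[P]_w (h w * (rho w * f w))%:E)%E.
  move=> uh; have mh := unit_wrt_measurable sF uh.
  have := intG _ (unit_wrtM uh ur).
  under [X in _ = X -> _]eq_integral do rewrite -EFinM -mulrA.
  move=> <-; apply: ae_eq_integral => //.
  - apply/measurable_EFinP; apply: measurable_funM => //.
    by apply: measurable_funM => //; exact: measurable_wrtW mg.
  - apply: emeasurable_funM; last exact: measurable_wrtW mG.
    by apply/measurable_EFinP; exact: measurable_funM.
  - by apply: filterS Gfin => w /(_ I) -> _; rewrite /= -EFinM mulrA.
exists g; split => //.
- apply/integrableP; split.
    apply/measurable_EFinP; apply: measurable_funM => //.
    exact: measurable_wrtW mg.
  under eq_integral do rewrite /= ger0_norm ?mulr_ge0 ?(ltW (r0 _))// -[_ * _]mul1r.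
  rewrite (int_eq _ (weight_unit weight1)).
  have /integrableP[_] := Lf.
  under eq_integral do rewrite /= ger0_norm ?mulr_ge0 ?(ltW (r0 _))//.
  by under [X in _ -> (X < _)%E]eq_integral do rewrite mul1r.
- by move=> h uh; rewrite /Rintegral int_eq.
- by apply: filterS2 eG Gfin => w e1 e2 _; rewrite e1// e2.
Qed.

(** Under the weight both the positive and the negative part have finite conditional expectations,
    so the subtraction in [gcondexp] is a.e. one of real numbers. *)
Lemma gcondexp_weighted (f rho : T -> R) :
  measurable_fun [set: T] f -> weight rho -> L1 (fun w => rho w * f w) ->
  exists g : T -> R, [/\ measurable_wrt F g, L1 (fun w => rho w * g w),
    forall h, unit_wrt F h ->
      E (fun w => h w * (rho w * g w)) = E (fun w => h w * (rho w * f w)) &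
    ae_eq P [set: T] (gcondexp P F (EFin \o f)) (EFin \o g)].
Proof.
move=> mf wr Lf; have ur := weight_unit wr.
have mrho := unit_wrt_measurable sF ur.
have part (u : T -> R) : measurable_fun [set: T] u ->
    (forall w, 0 <= u w <= `|f w|) -> L1 (fun w => rho w * u w).
  move=> mu ule; apply: (L1_le _ (L1_norm Lf)); first exact: measurable_funM.
  move=> w; have /andP[u0 uf] := ule w; rewrite !normrM ler_wpM2l//.
  by rewrite ger0_norm.
pose fp w := Num.max (f w) 0; pose fn w := Num.max (- f w) 0.
have fp_ge0 w : 0 <= fp w by rewrite /fp le_max lexx orbT.
have fn_ge0 w : 0 <= fn w by rewrite /fn le_max lexx orbT.
have mfp : measurable_fun [set: T] fp by exact: measurable_maxr.
have mfn : measurable_fun [set: T] fn by apply: measurable_maxr => //; exact: measurableT_comp.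
have Lp : L1 (fun w => rho w * fp w).
  apply: part => // w; rewrite fp_ge0 /fp ge_max ler_norm.
  exact: normr_ge0.
have Ln : L1 (fun w => rho w * fn w).
  apply: part => // w; rewrite fn_ge0 /fn ge_max -normrN ler_norm.
  exact: normr_ge0.
have fE w : f w = fp w - fn w.
  by rewrite /fp /fn /Num.max; case: ltP => ?; case: ltP => ?; lra.
have [p [mp Lrp Ep ep]] := gcondexp_ge0_weighted mfp fp_ge0 wr Lp.
have [n [mn Lrn En en]] := gcondexp_ge0_weighted mfn fn_ge0 wr Ln.
have distr (u v : T -> R) : (fun w => rho w * (u w - v w)) =
    (fun w => rho w * u w - rho w * v w).
  by apply/funext => w; rewrite mulrBr.
exists (fun w => p w - n w); split.
- exact: measurable_funB.
- by rewrite distr; exact: L1_B.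
- move=> h uh.
  have split2 (u v : T -> R) : L1 (fun w => rho w * u w) ->
      L1 (fun w => rho w * v w) ->
      E (fun w => h w * (rho w * (u w - v w))) =
      E (fun w => h w * (rho w * u w)) - E (fun w => h w * (rho w * v w)).
    move=> Lu Lv; rewrite -(E_B (L1_unit_mul sF uh Lu) (L1_unit_mul sF uh Lv)).
    by congr Rintegral; apply/funext => w; rewrite !mulrBr.
  rewrite split2// Ep// En// -split2//.
  by congr Rintegral; apply/funext => w; rewrite -fE.
- have Efp : ((EFin \o f)^\+ = EFin \o fp)%E.
    by apply/funext => w; rewrite funeposE /= /fp EFin_max.
  have Efn : ((EFin \o f)^\- = EFin \o fn)%E.
    by apply/funext => w; rewrite funenegE /= /fn EFin_max.
  apply: filterS2 ep en => w /(_ I) ep /(_ I) en _.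
  by rewrite /gcondexp Efp Efn ep en.
Qed.

(** Two candidates agree after multiplication by [rho], which is then cancelled. This is how a
    function is recognized as the conditional expectation of [f]. *)
Lemma gcondexp_unique (f rho g : T -> R) :
  measurable_fun [set: T] f -> weight rho -> L1 (fun w => rho w * f w) ->
  measurable_wrt F g -> L1 (fun w => rho w * g w) ->
  (forall h, unit_wrt F h ->
    E (fun w => h w * (rho w * g w)) = E (fun w => h w * (rho w * f w))) ->
  ae_eq P [set: T] (gcondexp P F (EFin \o f)) (EFin \o g).
Proof.
move=> mf wr Lf mg Lg gE; have [g' [mg' Lg' gE' eg']] := gcondexp_weighted mf wr Lf.
have : ae_eq P [set: T] (fun w => rho w * g' w) (fun w => rho w * g w).
  apply: (wrt_eq_ae sF) => //.
  - exact: (measurable_funM wr.1 mg').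
  - exact: (measurable_funM wr.1 mg).
  - by move=> h uh; rewrite gE' ?gE.
apply: filterS2 eg' => w /(_ I) -> /(_ I) /= e _; congr EFin.
by apply: (mulfI (lt0r_neq0 (weight_gt0 w wr))).
Qed.

End weights.

(** * Orlicz modules *)

Section gauges.
Local Open Scope ereal_scope.
Context (R : realType).

(* What Young functions and their conjugates have in common, as far as the
   modules they generate are concerned. *)
Record gauge (psi : R -> \bar R) : Prop := {
  gauge_ge0 : forall r : R, (0 <= r)%R -> 0 <= psi r ;
  gauge_nd : forall r s : R, (0 <= r)%R -> (r <= s)%R -> psi r <= psi s ;
  gauge_scale : forall t r : R, (0 <= t <= 1)%R -> (0 <= r)%R ->
    psi (t * r)%R <= t%:E * psi r }.

Lemma young_gauge (phi : R -> \bar R) : young_function phi -> gauge phi.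
Proof.
case=> ge0 nd _ cvx _ phi0 _; split => // t r t01 r0.
by have := cvx _ _ _ r0 (lexx 0%R) t01; rewrite mulr0 addr0 phi0 mule0 adde0.
Qed.

Lemma young_conjugate_ge0 (phi : R -> \bar R) (s : R) :
  young_function phi -> 0 <= young_conjugate phi s.
Proof.
move=> yphi; apply: ereal_sup_ubound.
exists 0%R; first by rewrite /= in_itv /= lexx.
by rewrite mul0r (young0 yphi) sube0.
Qed.

Lemma young_inequality (phi : R -> \bar R) (r s : R) : young_function phi ->
  (0 <= r)%R -> (r * s)%:E <= phi r + young_conjugate phi s.
Proof.
move=> yphi r0; have := young_ge0 yphi r0.
have : (r * s)%:E - phi r <= young_conjugate phi s.
  by apply: ereal_sup_ubound; exists r => //; rewrite /= in_itv /= r0.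
have := young_conjugate_ge0 s yphi; move: (young_conjugate _ _) => c.
case: (phi r) => [p||] //= c0; last first.
  by rewrite addye ?leey// gt_eqF// (lt_le_trans _ c0).
move=> h _; case: c c0 h => [c||] //= _; rewrite ?addey ?leey//.
by rewrite !lee_fin; lra.
Qed.

(** Scaling: for [t <= 1] and [phi q >= 0], [q (t r) - phi q <= t (q r - phi q)]; where [phi q] is
    infinite the left side is [-oo]. *)
Lemma conjugate_gauge (phi : R -> \bar R) :
  young_function phi -> gauge (young_conjugate phi).
Proof.
move=> yphi; split => [r _|r s r0 rs|t r /andP[t0 t1] r0].
- exact: young_conjugate_ge0.
- apply: ge_ereal_sup => _ [q /= + <-]; rewrite in_itv /= andbT => q0.
  apply: le_trans (_ : (q * s)%:E - phi q <= _); last first.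
    by apply: ereal_sup_ubound; exists q => //; rewrite /= in_itv /= q0.
  by apply: leeB => //; rewrite lee_fin ler_wpM2l.
- apply: ge_ereal_sup => _ [q /= + <-]; rewrite in_itv /= andbT => q0.
  apply: le_trans (_ : t%:E * ((q * r)%:E - phi q) <= _); last first.
    rewrite lee_wpmul2l ?lee_fin//.
    by apply: ereal_sup_ubound; exists q => //; rewrite /= in_itv /= q0.
  have := young_ge0 yphi q0; case: (phi q) => [p||] //= p0.
    by rewrite lee_fin; move: p0; rewrite lee_fin => p0; nra.
  by rewrite leNye.
Qed.

(** By monotonicity the sublevel sets of [psi |r|] are intervals: a point between [s] and [t] has
    absolute value at most that of one of them. *)
Lemma gauge_measurable (psi : R -> \bar R) : gauge psi ->
  measurable_fun [set: R] (fun r => psi `|r|%R).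
Proof.
move=> gpsi; apply: (measurability (@ErealGenOInfty.G R)).
  exact: ErealGenOInfty.measurableE.
move=> /= _ [_] [r] -> <-; rewrite setTI -[X in measurable X]setCK.
apply: measurableC; apply: is_interval_measurable => s t /=.
rewrite !in_itv/= !andbT => /negP fs /negP ft u /andP[su ut]; apply/negP.
move: fs ft; rewrite -!leNgt => fs ft.
have : (`|u| <= `|s|)%R \/ (`|u| <= `|t|)%R.
  have [u0|u0] := leP 0%R u; [right|left].
    by rewrite !ger0_norm// (le_trans u0).
  by rewrite !ltr0_norm ?lerN2// (le_lt_trans su).
rewrite in_itv /= andbT -leNgt.
by case=> h; [apply: (le_trans _ fs)|apply: (le_trans _ ft)]; exact: gauge_nd.
Qed.

End gauges.

Section orlicz.
Context d (T : measurableType d) (R : realType) (P : probability T R).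
Variables (F : set (set T)) (sF : sub_sigma_field F).

Notation L1 f := (P.-integrable [set: T] (EFin \o f)).
Notation E f := (Rintegral P [set: T] f).

Section gauge_module.
Variables (psi : R -> \bar R) (gpsi : gauge psi).

Lemma gauge_comp_ge0 (x : T -> R) w : (0 <= psi `|x w|%R)%E.
Proof. exact: gauge_ge0. Qed.

Lemma gauge_comp_measurable d' (T' : measurableType d') (x : T' -> R) :
  measurable_fun [set: T'] x ->
  measurable_fun [set: T'] (fun w => psi `|x w|%R).
Proof. by move=> mx; exact: (measurableT_comp (gauge_measurable gpsi) mx). Qed.

Lemma gauge_integral_le (x x' : T -> R) : measurable_fun [set: T] x ->
  measurable_fun [set: T] x' -> {ae P, forall w, `|x' w| <= `|x w|} ->
  (\int[P]_w psi `|x' w|%R <= \int[P]_w psi `|x w|%R)%E.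
Proof.
move=> mx mx' xx'; apply: ae_ge0_le_integral => //.
- by move=> w _; exact: gauge_ge0.
- exact: gauge_comp_measurable.
- by move=> w _; exact: gauge_ge0.
- exact: gauge_comp_measurable.
- by apply: filterS xx' => w xx' _; exact: gauge_nd.
Qed.

(** Conditional finiteness gives a weight [rho] with [rho psi(eta |x|)] integrable, and
    [gauge_scale] moves [rho] inside [psi]. Membership thus becomes a plain integral with a single
    weight. *)
Lemma orlicz_moduleP (x : T -> R) : orlicz_module P F psi x <->
  measurable_fun [set: T] x /\
  exists2 rho, weight F rho & (\int[P]_w psi `|rho w * x w|%R < +oo)%E.
Proof.
split=> [[mx [eta [meta eta0] fin]]|[mx [rho wr fin]]]; split => //.
  (* A weight must be positive everywhere, whereas [eta] is so only a.e.; the value 1 fills the null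
     set, and the minimum with 1 bounds it. *)
  pose e w := if 0 < eta w then Num.min 1 (eta w) else 1.
  have me : measurable_wrt F e.
    apply: measurable_fun_ifT.
    - by apply: measurable_fun_ltr => //; exact: measurable_cst.
    - by apply: measurable_minr => //; exact: measurable_cst.
    - exact: measurable_cst.
  have we : weight F e.
    split => // w; rewrite /e; case: ifPn => [e0|_]; last by rewrite ltr01 lexx.
    by rewrite lt_min ltr01 e0 ge_min lexx.
  have meta' := measurable_wrtW sF meta.
  have mex : measurable_fun [set: T] (fun w => eta w * x w).
    exact: measurable_funM.
  have [rho wr int] := (gcondexp_fin_numP P sF (gauge_comp_measurable mex)
    (gauge_comp_ge0 (fun w => eta w * x w))).1 fin.
  have mrho := unit_wrt_measurable sF (weight_unit wr).
  exists (fun w => rho w * e w); first exact: weightM.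
  apply: le_lt_trans int; apply: ae_ge0_le_integral => //.
  - by move=> w _; exact: gauge_ge0.
  - apply: gauge_comp_measurable; apply: measurable_funM => //.
    by apply: measurable_funM => //; exact: measurable_wrtW me.
  - by move=> w _; apply: mule_ge0; [rewrite lee_fin ltW ?(weight_gt0 w wr)|exact: gauge_ge0].
  - apply: emeasurable_funM; first exact/measurable_EFinP.
    exact: gauge_comp_measurable.
  - apply: filterS eta0 => w eta0 _.
    have /andP[r0 r1] := wr.2 w.
    apply: (@le_trans _ _ (psi (rho w * `|eta w * x w|)%R)); last first.
      by apply: gauge_scale => //; rewrite ltW.
    apply: gauge_nd => //; rewrite -mulrA normrM (gtr0_norm r0) ler_wpM2l ?(ltW r0)//.
    rewrite !normrM ler_wpM2r// /e eta0 (gtr0_norm eta0) ger0_norm.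
      by rewrite ge_min lexx orbT.
    by rewrite le_min ler01 ltW.
exists rho; first by split; [exact: wr.1|apply: aeW => w; exact: (weight_gt0 w wr)].
have mrx : measurable_fun [set: T] (fun w => rho w * x w).
  apply: measurable_funM => //.
  exact: unit_wrt_measurable sF _ (weight_unit wr).
apply/(gcondexp_fin_numP P sF (gauge_comp_measurable mrx)
  (gauge_comp_ge0 (fun w => rho w * x w))).
exists (cst 1); first exact: weight1.
by under eq_integral do rewrite mul1e.
Qed.

Lemma orlicz_measurable x : orlicz_module P F psi x -> measurable_fun [set: T] x.
Proof. by case. Qed.

Lemma orlicz_ideal (x x' : T -> R) : orlicz_module P F psi x ->
  measurable_fun [set: T] x' -> {ae P, forall w, `|x' w| <= `|x w|} ->
  orlicz_module P F psi x'.
Proof.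
move=> /orlicz_moduleP[mx [rho wr fin]] mx' xx'; apply/orlicz_moduleP.
split => //; exists rho => //; apply: le_lt_trans fin.
have mrho := unit_wrt_measurable sF (weight_unit wr).
apply: gauge_integral_le; [exact: measurable_funM..|].
by apply: filterS xx' => w xx'; rewrite !normrM ler_wpM2l.
Qed.

Lemma orlicz_add_norm (x x' : T -> R) : orlicz_module P F psi x ->
  orlicz_module P F psi x' -> orlicz_module P F psi (fun w => `|x w| + `|x' w|).
Proof.
move=> /orlicz_moduleP[mx [rho wr fin]] /orlicz_moduleP[mx' [rho' wr' fin']].
apply/orlicz_moduleP; split; first by apply: measurable_funD; exact: measurableT_comp.
have mrho := unit_wrt_measurable sF (weight_unit wr).
have mrho' := unit_wrt_measurable sF (weight_unit wr').
(* A gauge is monotone, so the factor 1/2 serves to bound the average of two numbers by the larger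
   one, and its image under [psi] by the sum of both images. *)
exists (fun w => 2^-1 * (rho w * rho' w)).
  split; first exact: (measurable_funM (measurable_cst _) (weightM wr wr').1).
  by move=> w; have := (weightM wr wr').2 w; lra.
have m1 : measurable_fun [set: T] (fun w => psi `|rho w * x w|%R).
  by apply: gauge_comp_measurable; exact: measurable_funM.
have m2 : measurable_fun [set: T] (fun w => psi `|rho' w * x' w|%R).
  by apply: gauge_comp_measurable; exact: measurable_funM.
apply: (@le_lt_trans _ _
  (\int[P]_w (psi `|rho w * x w|%R + psi `|rho' w * x' w|%R))%E); last first.
  have nn1 w : [set: T] w -> (0 <= psi `|rho w * x w|%R)%E.
    by move=> _; exact: gauge_ge0.
  have nn2 w : [set: T] w -> (0 <= psi `|rho' w * x' w|%R)%E.
    by move=> _; exact: gauge_ge0.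
  by rewrite (ge0_integralD P measurableT nn1 m1 nn2 m2) lte_add_pinfty.
apply: ge0_le_integral => //.
- by move=> w _; exact: gauge_ge0.
- apply: gauge_comp_measurable; apply: measurable_funM.
    by apply: measurable_funM => //; exact: measurable_funM.
  by apply: measurable_funD; exact: measurableT_comp.
- exact: emeasurable_funD.
- move=> w _; have /andP[r0 r1] := wr.2 w; have /andP[r0' r1'] := wr'.2 w.
  have rx : rho w * rho' w * `|x w| <= `|rho w * x w|.
    by rewrite normrM (gtr0_norm r0) -mulrA ler_wpM2l ?ler_piMl// ltW.
  have rx' : rho w * rho' w * `|x' w| <= `|rho' w * x' w|.
    by rewrite normrM (gtr0_norm r0') [_ * rho' w]mulrC -mulrA ler_wpM2l ?ler_piMl// ltW.
  have nn : 0 <= 2^-1 * (rho w * rho' w) * (`|x w| + `|x' w|).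
    by rewrite mulr_ge0 ?addr_ge0// mulr_ge0 ?invr_ge0// mulr_ge0// ltW.
  rewrite (ger0_norm nn); have [xx'|xx'] := leP `|rho w * x w| `|rho' w * x' w|.
    apply: (@le_trans _ _ (psi `|rho' w * x' w|%R)); last first.
      by rewrite leeDr// gauge_ge0.
    by apply: gauge_nd => //; lra.
  apply: (@le_trans _ _ (psi `|rho w * x w|%R)); last first.
    by rewrite leeDl// gauge_ge0.
  by apply: gauge_nd => //; lra.
Qed.

(** The factor [eta] is absorbed by enlarging the weight with [damping eta], since their product is
    bounded by 1. *)
Lemma orlicz_mul (x eta : T -> R) : orlicz_module P F psi x ->
  measurable_wrt F eta -> orlicz_module P F psi (fun w => eta w * x w).
Proof.
move=> /orlicz_moduleP[mx [rho wr fin]] meta; apply/orlicz_moduleP.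
have meta' := measurable_wrtW sF meta.
have mrho := unit_wrt_measurable sF (weight_unit wr).
have wd := weight_damping meta.
have md := unit_wrt_measurable sF (weight_unit wd).
split; first exact: measurable_funM.
exists (fun w => rho w * damping eta w); first exact: weightM.
apply: le_lt_trans fin; apply: gauge_integral_le; first exact: measurable_funM.
  by apply: measurable_funM; exact: measurable_funM.
apply: aeW => w; rewrite -mulrA !normrM ler_wpM2l// mulrA ler_piMl//.
by rewrite -normrM damping_le1.
Qed.

Lemma orlicz_cst : (exists2 t : R, 0 < t & (psi t < +oo)%E) ->
  forall c, orlicz_module P F psi (cst c).
Proof.
move=> [t t0 fin] c.
have L1c : orlicz_module P F psi (cst 1).
  apply/orlicz_moduleP; split; first exact: measurable_cst.
  exists (cst (Num.min 1 t)).
    split; first exact: measurable_cst.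
    by move=> w; rewrite lt_min ltr01 t0 ge_min lexx.
  apply: (@le_lt_trans _ _ (\int[P]_w (cst (psi t) w))%E).
    apply: ge0_le_integral => //.
    - by move=> w _; exact: gauge_ge0.
    - exact: (measurable_cst (psi `|Num.min 1 t * 1|%R)).
    - move=> w _; apply: gauge_nd => //; rewrite mulr1 ger0_norm.
        by rewrite ge_min lexx orbT.
      by rewrite le_min ler01 ltW.
  by rewrite integral_cst//; have /= -> := probability_setT P; rewrite mule1.
have := orlicz_mul L1c (measurable_cst c : measurable_wrt F (cst c)).
by congr (orlicz_module P F psi _); apply/funext => w; rewrite mulr1.
Qed.

End gauge_module.

Lemma young_finite_at (phi : R -> \bar R) : young_function phi ->
  exists2 t : R, 0 < t & (phi t < +oo)%E.
Proof.
move=> yphi; have [e /= e0 He] := young_finite yphi.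
exists (e / 2); first exact: divr_gt0.
apply: He => /=; last exact: divr_gt0.
rewrite sub0r normrN gtr0_norm ?divr_gt0//; lra.
Qed.

Lemma orlicz_bounded (phi : R -> \bar R) (x : T -> R) c : young_function phi ->
  measurable_fun [set: T] x -> (forall w, `|x w| <= c) -> orlicz_module P F phi x.
Proof.
move=> yphi mx xc; have gphi := young_gauge yphi.
apply: (orlicz_ideal gphi (orlicz_cst gphi (young_finite_at yphi) c)) => //.
by apply: aeW => w; apply: le_trans (xc w) _; exact: ler_norm.
Qed.

(** Young's inequality for [rho x] and [rho' y], the product of the two weights being distributed
    over the two factors. *)
Lemma orlicz_pairing (phi : R -> \bar R) (x y : T -> R) : young_function phi ->
  orlicz_module P F phi x -> orlicz_module P F (young_conjugate phi) y ->
  exists2 rho, weight F rho & L1 (fun w => rho w * (x w * y w)).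
Proof.
move=> yphi.
move=> /(orlicz_moduleP (young_gauge yphi))[mx [rho wr fin]].
move=> /(orlicz_moduleP (conjugate_gauge yphi))[my [rho' wr' fin']].
have mrho := unit_wrt_measurable sF (weight_unit wr).
have mrho' := unit_wrt_measurable sF (weight_unit wr').
have g := young_gauge yphi; have g' := conjugate_gauge yphi.
have m1 : measurable_fun [set: T] (fun w => phi `|rho w * x w|%R).
  by apply: gauge_comp_measurable => //; exact: measurable_funM.
have m2 : measurable_fun [set: T] (fun w => young_conjugate phi `|rho' w * y w|%R).
  by apply: gauge_comp_measurable => //; exact: measurable_funM.
exists (fun w => rho w * rho' w); first exact: weightM.
apply/integrableP; split.
  by apply/measurable_EFinP; do 2 (apply: measurable_funM => //).
apply: (@le_lt_trans _ _ (\int[P]_w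
    (phi `|rho w * x w|%R + young_conjugate phi `|rho' w * y w|%R))%E); last first.
  have nn1 w : [set: T] w -> (0 <= phi `|rho w * x w|%R)%E.
    by move=> _; exact: gauge_ge0 g _ _.
  have nn2 w : [set: T] w -> (0 <= young_conjugate phi `|rho' w * y w|%R)%E.
    by move=> _; exact: gauge_ge0 g' _ _.
  by rewrite (ge0_integralD P measurableT nn1 m1 nn2 m2) lte_add_pinfty.
apply: ge0_le_integral => //.
- by apply: measurableT_comp => //; apply/measurable_EFinP; do 2 (apply: measurable_funM => //).
- exact: emeasurable_funD.
- move=> w _ /=; apply: le_trans (young_inequality _ yphi _) => //.
  by rewrite lee_fin -normrM mulrACA.
Qed.

End orlicz.

(** * Functionals represented by an element of the conjugate module *)

Section representable.
Context d (T : measurableType d) (R : realType) (P : probability T R).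
Variables (F : set (set T)) (sF : sub_sigma_field F).
Variables (phi : R -> \bar R) (yphi : young_function phi).

Notation L1 f := (P.-integrable [set: T] (EFin \o f)).
Notation E f := (Rintegral P [set: T] f).
Notation Lphi := (orlicz_module P F phi).
Notation Lconj := (orlicz_module P F (young_conjugate phi)).

Lemma decreasing_between (x_ : nat -> T -> R) :
  {ae P, forall w, nonincreasing_seq (x_ ^~ w) /\ x_ n w @[n --> \oo] --> 0} ->
  {ae P, forall w n, 0 <= x_ n w <= x_ 0%N w}.
Proof.
apply: filterS => w [nd cw] n; rewrite (nd _ _ (leq0n n)) andbT.
rewrite -[X in X <= _](cvg_lim _ cw)//; apply: nonincreasing_cvgn_ge => //.
by apply/cvg_ex; exists 0.
Qed.

Lemma wrt_abs_le_ae (g b : T -> R) : measurable_wrt F g -> measurable_wrt F b ->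
  L1 g -> L1 b ->
  (forall h, unit_wrt F h -> `|E (fun w => h w * g w)| <= E (fun w => h w * b w)) ->
  {ae P, forall w, `|g w| <= b w}.
Proof.
move=> mg mb Lg Lb gb.
have mNg : measurable_wrt F (fun w => - 1 * g w).
  by apply: measurable_funM => //; exact: measurable_cst.
have h1 : {ae P, forall w, g w <= b w}.
  apply: (wrt_le_ae sF mg mb Lg Lb) => h uh.
  exact: le_trans (ler_norm _) (gb h uh).
have h2 : {ae P, forall w, - 1 * g w <= b w}.
  apply: (wrt_le_ae sF mNg mb (L1_Z (-1) Lg) Lb) => h uh.
  apply: le_trans (gb h uh).
  rewrite (_ : (fun w => _) = (fun w => -1 * (h w * g w))); last first.
    by apply/funext => w; rewrite mulrCA.
  by rewrite (E_Z _ (L1_unit_mul sF uh Lg)) mulN1r -normrN ler_norm.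
by apply: filterS2 h1 h2 => w h1 h2; rewrite ler_norml; lra.
Qed.

Variables (mu : (T -> R) -> T -> R) (hmu : module_hom P F Lphi mu).

Let mu_measurable x : Lphi x -> measurable_wrt F (mu x).
Proof. by case: hmu => _ + _ _; apply. Qed.

Section one_representative.
Variables (y : T -> R) (my : measurable_fun [set: T] y).
Hypothesis rep : represents P F Lphi mu y.

Lemma represents_test (x rho : T -> R) : Lphi x -> weight F rho ->
  L1 (fun w => rho w * (x w * y w)) ->
  L1 (fun w => rho w * mu x w) /\
  forall h, unit_wrt F h ->
    E (fun w => h w * (rho w * mu x w)) = E (fun w => h w * (rho w * (x w * y w))).
Proof.
move=> Lx wr L; have mx := orlicz_measurable Lx.
have [g [mg Lg gE eg]] := gcondexp_weighted sF (measurable_funM mx my) wr L.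
have mr := unit_wrt_measurable sF (weight_unit wr).
have mmu := measurable_wrtW sF (mu_measurable Lx).
have e : ae_eq P [set: T] (mu x) g.
  by apply: filterS2 (rep Lx) eg => w e1 e2 _; apply/EFin_inj; rewrite -[RHS]e2// -e1.
have eR : ae_eq P [set: T] (fun w => rho w * g w) (fun w => rho w * mu x w).
  by apply: filterS e => w /(_ I) ->.
have mrmu : measurable_fun [set: T] (fun w => rho w * mu x w) by exact: measurable_funM.
have L' := L1_ae_eq mrmu eR Lg; split => // h uh; rewrite -gE//; apply: E_ae_eq.
- exact: (L1_measurable (L1_unit_mul sF uh L')).
- exact: (L1_measurable (L1_unit_mul sF uh Lg)).
- by apply: filterS eR => w /(_ I) ->.
Qed.

(** [b] is a conditional expectation of [|c y|]. One and the same [b] serves all [x] dominated by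
    [c], which gives order boundedness; its weighted mean being exactly that of [|c y|] gives
    sigma-order continuity. *)
Lemma represents_bound (c rho : T -> R) : Lphi c -> weight F rho ->
  L1 (fun w => rho w * (c w * y w)) ->
  exists b : T -> R, [/\ measurable_wrt F b, L1 (fun w => rho w * b w),
    E (fun w => rho w * b w) = E (fun w => `|rho w * (c w * y w)|) &
    forall x, Lphi x -> {ae P, forall w, `|x w| <= `|c w|} ->
      {ae P, forall w, `|mu x w| <= b w}].
Proof.
move=> Lc wr L; have mc := orlicz_measurable Lc.
have mr := unit_wrt_measurable sF (weight_unit wr).
have mcy : measurable_fun [set: T] (fun w => `|c w * y w|).
  by apply: measurableT_comp => //; exact: measurable_funM.
have absE w : `|rho w * (c w * y w)| = rho w * `|c w * y w|.
  by rewrite normrM gtr0_norm// (weight_gt0 w wr).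
have Labs : L1 (fun w => rho w * `|c w * y w|).
  by have := L1_norm L; under [X in P.-integrable _ (_ \o X) -> _]funext do rewrite absE.
have [b [mb Lb bE _]] := gcondexp_weighted sF mcy wr Labs.
exists b; split => //.
  have := bE _ (weight_unit (weight1 R F)).
  rewrite /cst; under [X in Rintegral _ _ X = _ -> _]funext do rewrite mul1r.
  under [X in _ = Rintegral _ _ X -> _]funext do rewrite mul1r -absE.
  by [].
move=> x Lx xc; have mx := orlicz_measurable Lx.
have xcy : {ae P, forall w, `|rho w * (x w * y w)| <= rho w * `|c w * y w|}.
  apply: filterS xc => w xc; rewrite normrM gtr0_norm ?(weight_gt0 w wr)//.
  by rewrite ler_pM2l ?(weight_gt0 w wr)// !normrM ler_wpM2r.
have Lxy : L1 (fun w => rho w * (x w * y w)).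
  by apply: L1_le_ae Labs xcy; apply: measurable_funM => //; exact: measurable_funM.
have [Lmu muE] := represents_test Lx wr Lxy.
have : {ae P, forall w, `|rho w * mu x w| <= rho w * b w}.
  apply: wrt_abs_le_ae => //.
  - exact: (measurable_funM wr.1 (mu_measurable Lx)).
  - exact: (measurable_funM wr.1 mb).
  - move=> h uh; rewrite muE// bE//.
    apply: le_trans (E_norm (L1_unit_mul sF uh Lxy)) _.
    apply: E_le_ae; [exact/L1_norm/(L1_unit_mul sF uh Lxy)|
                     exact: (L1_unit_mul sF uh Labs)|].
    apply: filterS xcy => w xcy; rewrite normrM.
    have /andP[h0 _] := uh.2 w; rewrite (ger0_norm h0).
    exact: ler_wpM2l.
apply: filterS => w; rewrite normrM (gtr0_norm (weight_gt0 w wr)).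
by rewrite ler_pM2l// (weight_gt0 w wr).
Qed.

Hypothesis Ly : Lconj y.

Lemma represents_order_bounded : order_bounded P F Lphi mu.
Proof.
move=> A [AX [a [b [La Lb Aab]]]]; split.
  by move=> _ [x Ax <-]; exact: (mu_measurable (AX _ Ax)).
(* [|a| + |b|] dominates every element of the order interval from [a] to [b]. *)
have Lc := orlicz_add_norm sF (young_gauge yphi) La Lb.
have [rho wr Lr] := orlicz_pairing sF yphi Lc Ly.
have [m [mm _ _ mB]] := represents_bound Lc wr Lr.
exists (fun w => - m w), m; split => //.
  exact: (measurableT_comp (@oppr_measurable R _) mm).
move=> _ [x Ax <-]; have Lx := AX _ Ax.
have : {ae P, forall w, `|mu x w| <= m w}.
  apply: mB => //; apply: filterS (Aab x Ax) => w /andP[ax xb].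
  rewrite [leRHS]ger0_norm ?addr_ge0// ler_norml.
  have := ler_norm (b w); have := ler_norm (- a w); rewrite normrN.
  by have := normr_ge0 (a w); have := normr_ge0 (b w); lra.
by apply: filterS => w; rewrite ler_norml.
Qed.

Lemma represents_sigma_order_continuous : sigma_order_continuous P Lphi mu.
Proof.
move=> x_ Lx cx; split; first exact: measurable_cst.
  by move=> n; apply: aeW => w; rewrite lee_fin.
move=> h mh hle.
have [rho wr Lr] := orlicz_pairing sF yphi (Lx 0%N) Ly.
have mr := unit_wrt_measurable sF (weight_unit wr).
have x0 := decreasing_between cx.
have dom n : {ae P, forall w,
    `|rho w * (x_ n w * y w)| <= `|rho w * (x_ 0%N w * y w)|}.
  apply: filterS x0 => w /[dup] /(_ n) /andP[x0 xn] /(_ 0%N) /andP[x00 _].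
  by rewrite !normrM ler_wpM2l// ler_wpM2r// !ger0_norm.
have mrxy n : measurable_fun [set: T] (fun w => rho w * (x_ n w * y w)).
  apply: measurable_funM => //; apply: measurable_funM => //.
  exact: orlicz_measurable (Lx n).
have Ln n : L1 (fun w => rho w * (x_ n w * y w)).
  by apply: L1_le_ae (L1_norm Lr) (dom n).
(* The positive part of the lower bound [h], made real. It need not be [F]-measurable, so it is
   compared with the [F]-measurable bounds of [|mu (x_ n)|] through expectations, which tend to 0 by
   domination. *)
pose k w := fine (maxe (h w) 0%E).
have k0 w : 0 <= k w by rewrite fine_ge0// le_max lexx orbT.
have mk : measurable_fun [set: T] k.
  by apply: measurableT_comp => //; exact: measurable_maxe.
have kfin n : {ae P, forall w, (k w)%:E = maxe (h w) 0%E /\ k w <= `|mu (x_ n) w|}.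
  apply: filterS (hle n) => w hw.
  have e : (k w)%:E = maxe (h w) 0%E.
    rewrite fineK// ge0_fin_numE ?le_max ?lexx ?orbT//.
    by rewrite gt_max (le_lt_trans hw) ?ltry.
  by split => //; rewrite -lee_fin e ge_max hw lee_fin normr_ge0.
have kle n : L1 (fun w => rho w * k w) /\
    E (fun w => rho w * k w) <= E (fun w => `|rho w * (x_ n w * y w)|).
  have [b [mb Lb <- bB]] := represents_bound (Lx n) wr (Ln n).
  have kb : {ae P, forall w, rho w * k w <= rho w * b w}.
    have := bB _ (Lx n) (aeW _ (fun w => lexx _)).
    apply: filterS2 (kfin n) => w [_ kn] nb.
    by rewrite ler_wpM2l ?(ltW (weight_gt0 w wr))// (le_trans kn).
  have L : L1 (fun w => rho w * k w).
    apply: L1_le_ae Lb _; first exact: measurable_funM.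
    apply: filterS kb => w; rewrite ger0_norm//.
    by rewrite mulr_ge0// ltW// (weight_gt0 w wr).
  by split => //; exact: E_le_ae.
have [_ cE] : L1 (cst 0 : T -> R) /\
    E (fun w => `|rho w * (x_ n w * y w)|) @[n --> \oo] --> E (cst 0 : T -> R).
  apply: E_dominated (L1_norm Lr) _.
  - by move=> n; exact: measurableT_comp.
  - exact: measurable_cst.
  - apply: filterS cx => w [_ cw]; rewrite -[X in _ --> X](@normr0 _ R).
    apply: cvg_norm; rewrite -(mulr0 (rho w)); apply: cvgMr.
    by rewrite -[X in _ --> X](mul0r (y w)); exact: cvgMl.
  - by move=> n; apply: filterS (dom n) => w; rewrite normr_id.
rewrite E_cst in cE.
have Lk := (kle 0%N).1.
have rk0 w : 0 <= rho w * k w by rewrite mulr_ge0// ltW// (weight_gt0 w wr).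
have Ek : E (fun w => rho w * k w) <= 0.
  rewrite -(cvg_lim _ cE)//; apply: limr_ge; first by apply/cvg_ex; exists 0.
  by apply: nearW => n; exact: (kle n).2.
have := E_eq0 Lk rk0 Ek; apply: filterS2 (kfin 0%N) => w [ke _] /(_ I) /eqP.
rewrite mulf_eq0 gt_eqF ?(weight_gt0 w wr)//= => /eqP k00.
have hm : (h w <= maxe (h w) 0)%E by rewrite le_max lexx.
by rewrite -ke k00 in hm.
Qed.

End one_representative.

(** For every measurable [A], in [F] or not, the integral of [1_A r y] equals that of [r mu 1_A] and
    so depends on [mu] only; these integrals determine [y]. *)
Lemma represents_unique y y' : Lconj y -> Lconj y' ->
  represents P F Lphi mu y -> represents P F Lphi mu y' -> ae_eq P [set: T] y y'.
Proof.
move=> Ly Ly' ry ry'.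
have my := orlicz_measurable Ly; have my' := orlicz_measurable Ly'.
have m1 : measurable_fun [set: T] (cst 1 : T -> R) by exact: measurable_cst.
have L11 : Lphi (cst 1).
  by apply: (orlicz_bounded P sF (c := 1) yphi m1) => w; rewrite normr1.
have [rho wr Lr] := orlicz_pairing sF yphi L11 Ly.
have [rho' wr' Lr'] := orlicz_pairing sF yphi L11 Ly'.
pose r w := rho w * rho' w; have wr2 : weight F r by exact: weightM.
have Lry : L1 (fun w => r w * y w).
  have := L1_unit_mul sF (weight_unit wr') Lr; congr (P.-integrable _ (_ \o _)).
  by apply/funext => w; rewrite /r mul1r mulrA [rho' w * _]mulrC.
have Lry' : L1 (fun w => r w * y' w).
  have := L1_unit_mul sF (weight_unit wr) Lr'; congr (P.-integrable _ (_ \o _)).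
  by apply/funext => w; rewrite /r mul1r mulrA.
have EA (A : set T) : measurable A ->
    E (fun w => \1_A w * (r w * y w)) = E (fun w => \1_A w * (r w * y' w)).
  move=> mA; have m1A : measurable_fun [set: T] (\1_A : T -> R).
    exact: measurable_indic.
  have bA w : `|\1_A w : R| <= 1.
    by rewrite indicE; case: (_ \in _); rewrite ?normr1 ?normr0 ?ler01.
  have LA : Lphi \1_A by exact: orlicz_bounded bA.
  have test z : measurable_fun [set: T] z -> L1 (fun w => r w * z w) ->
      represents P F Lphi mu z ->
      E (fun w => \1_A w * (r w * z w)) = E (fun w => r w * mu \1_A w).
    move=> mz Lz rz.
    have Lz' : L1 (fun w => r w * (\1_A w * z w)).
      have := L1_mul m1A bA Lz; congr (P.-integrable _ (_ \o _)).
      by apply/funext => w; rewrite mulrCA.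
    have [_ /(_ _ (weight_unit (weight1 R F))) e] := represents_test mz rz LA wr2 Lz'.
    transitivity (E (fun w => cst 1 w * (r w * (\1_A w * z w)))).
      by congr Rintegral; apply/funext => w; rewrite mul1r mulrCA.
    by rewrite -e; congr Rintegral; apply/funext => w; rewrite mul1r.
  by rewrite test// test.
(* An analogue of [wrt_le_ae] over the ambient sigma-algebra: the set [[v < u]] is measurable but in
   general not in [F]. *)
have le (u v : T -> R) : measurable_fun [set: T] u -> measurable_fun [set: T] v ->
    L1 (fun w => r w * u w) -> L1 (fun w => r w * v w) ->
    (forall A, measurable A ->
      E (fun w => \1_A w * (r w * u w)) = E (fun w => \1_A w * (r w * v w))) ->
    {ae P, forall w, u w <= v w}.
  move=> mu' mv Lu Lv uv; have mA := measurable_ltr_set mv mu'.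
  set A := [set w | _] in mA.
  have L z : L1 (fun w => r w * z w) -> L1 (fun w => \1_A w * (r w * z w)).
    apply: L1_mul; first exact: measurable_indic.
    by move=> w; rewrite indicE; case: (_ \in _); rewrite ?normr1 ?normr0 ?ler01.
  have nn w : 0 <= \1_A w * (r w * u w) - \1_A w * (r w * v w).
    rewrite -!mulrBr indicE; have r0 := weight_gt0 w wr2.
    case: (boolP (w \in A)); rewrite ?mul0r// inE /A /= mul1r => vu.
    by rewrite mulr_ge0// ?ltW// subr_gt0.
  have := E_eq0 (L1_B (L u Lu) (L v Lv)) nn.
  rewrite E_B ?uv ?subrr; [|exact: mA|exact: L|exact: L].
  move=> /(_ (lexx _)); apply: filterS => w /(_ I) /=.
  rewrite -!mulrBr indicE; have r0 := weight_gt0 w wr2.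
  case: (boolP (w \in A)); rewrite ?inE ?notin_setE /A /=; last first.
    by move=> /negP; rewrite -leNgt.
  by move=> vu; rewrite mul1r => /eqP; rewrite mulf_eq0 !gt_eqF// subr_gt0.
have h1 := le y y' my my' Lry Lry' EA.
have h2 := le y' y my' my Lry' Lry (fun A mA => esym (EA A mA)).
by apply: filterS2 h1 h2 => w h1 h2 _; apply/eqP; rewrite eq_le h1 h2.
Qed.

End representable.

(** * Densities of set functions *)

Section selection.
Context d (T : measurableType d).

(** [N] is the first index of entry. Since the measurable type is arbitrary, the lemma also yields
    indices measurable with respect to [F]. *)
Lemma first_index_measurable (A : nat -> set T) : (forall n, measurable (A n)) ->
  exists N : T -> nat, (forall n, measurable [set w | N w = n]) /\
    forall w n, A n w -> A (N w) w /\ (N w <= n)%N.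
Proof.
move=> mA; pose N w := if pselect (exists n, `[< A n w >]) is left e
  then ex_minn e else 0%N.
have NP w n : A n w -> A (N w) w /\ (N w <= n)%N.
  move=> Anw; rewrite /N; case: pselect => [e|[]]; last by exists n; exact/asboolP.
  case: ex_minnP => m /asboolP Am le; split => //; apply: le; exact/asboolP.
exists N; split => // n; have mU : measurable (\bigcup_m A m) by exact: bigcupT_measurable.
(* The default value 0 at points in no [A n] adds the complement of the union to the fibre of 0. *)
have -> : [set w | N w = n] = seqDU A n `|`
    (if n == 0%N then ~` (\bigcup_m A m) else set0).
  apply/seteqP; split => [w /= <-|w /= [[Anw nlt]|]].
  - have [[m _ Amw]|nU] := pselect ((\bigcup_m A m) w).
      left; split; first by have [] := NP w m Amw.
      rewrite -bigcup_mkord => -[k /= kN Akw].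
      by have [_] := NP w k Akw; rewrite leqNgt kN.
    right; rewrite /N; case: pselect => [e|_ //]; exfalso; apply: nU.
    by have [m /asboolP Amw] := e; exists m.
  - have [ANw] := NP w n Anw; rewrite leq_eqVlt => /predU1P[//|lt].
    by case: nlt; rewrite -bigcup_mkord; exists (N w).
  - case: eqP => [->|_ []] nU; rewrite /N; case: pselect => // e; exfalso; apply: nU.
    by have [m /asboolP Amw] := e; exists m.
apply: measurableU; last by case: ifP => _ //; exact: measurableC.
by apply: measurableD => //; exact: bigsetU_measurable.
Qed.

Lemma measurable_select (R : realType) (x_ : nat -> T -> R) (N : T -> nat) :
  (forall n, measurable_fun [set: T] (x_ n)) ->
  (forall n, measurable [set w | N w = n]) ->
  measurable_fun [set: T] (fun w => x_ (N w) w).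
Proof.
move=> mx mN _ Y mY; rewrite setTI.
rewrite (_ : _ @^-1` Y = \bigcup_n ([set w | N w = n] `&` (x_ n @^-1` Y))).
  apply: bigcupT_measurable => n; apply: measurableI => //.
  by rewrite -[X in measurable X]setTI; exact: mx.
by apply/seteqP; split => [w /= Yw|w /= [n _ [<-]]//]; exists (N w).
Qed.

End selection.

Section density.
Context d (T : measurableType d) (R : realType) (P : probability T R).

Notation L1 f := (P.-integrable [set: T] (EFin \o f)).
Notation E f := (Rintegral P [set: T] f).

(** Additivity and continuity along sequences decreasing to the empty set make [nu] a finite charge,
    which Radon-Nikodym turns into an integrable density. *)
Lemma set_function_density (nu : set T -> R) :
  (forall A B, measurable A -> measurable B -> A `&` B = set0 ->
    nu (A `|` B) = nu A + nu B) ->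
  (forall A : nat -> set T, (forall n, measurable (A n)) ->
    (forall n, A n.+1 `<=` A n) -> \bigcap_n A n = set0 ->
    nu (A n) @[n --> \oo] --> 0) ->
  (forall A, measurable A -> P A = 0%E -> nu A = 0) ->
  exists2 y : T -> R, L1 y & forall A, measurable A -> E (fun w => \1_A w * y w) = nu A.
Proof.
move=> nuU nucvg nuP; pose nu' A := (nu A)%:E.
have nu0 : nu set0 = 0 by apply: nuP => //; exact: measure0.
have nu'0 : nu' set0 = 0%E by rewrite /nu' nu0.
have nu'fin A : measurable A -> nu' A \is a fin_num by [].
have nu'sig : semi_sigma_additive nu'.
  move=> A mA tA mUA; pose U n := \big[setU/set0]_(i < n) A i.
  have mU n : measurable (U n) by exact: bigsetU_measurable.
  have US n : U n.+1 = U n `|` A n by rewrite /U big_ord_recr.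
  have sumU n : (\sum_(0 <= i < n) nu' (A i) = nu' (U n))%E.
    elim: n => [|n IH]; first by rewrite big_geq// /U big_ord0 nu'0.
    rewrite big_nat_recr//= IH US /nu' nuU//.
    rewrite /U -bigcup_mkord; apply/seteqP; split => // w [[k /= kn Ak] An].
    have /trivIsetP /(_ k n I I) := tA; rewrite (ltn_eqF kn) => /(_ isT) e.
    by have : (A k `&` A n) w by []; rewrite e.
  under eq_fun do rewrite sumU.
  apply: cvg_EFin; first exact: nearW.
  (* The remainders of the union decrease to the empty set, and [nu (U n)] is [nu] of the union
     minus [nu (D n)]. *)
  pose D n := \bigcup_n A n `\` U n.
  have mD n : measurable (D n) by exact: measurableD.
  have subU n : U n `<=` \bigcup_n A n.
    by rewrite /U -bigcup_mkord => w [k _ Ak]; exists k.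
  have cD : nu (D n) @[n --> \oo] --> 0.
    apply: nucvg => // [n w [Aw nU]|].
      by split => // Uw; apply: nU; rewrite US; left.
    apply/seteqP; split => // w Dw; have [[k _ Ak] _] := Dw 0%N I.
    by have [_ []] := Dw k.+1 I; rewrite US; right.
  have e n : (fine \o (fun n => nu' (U n))) n = nu (\bigcup_n A n) - nu (D n).
    have := nuU _ _ (mU n) (mD n); rewrite setDIK setDUK// => /(_ erefl) ->.
    by rewrite addrK.
  rewrite (_ : fine \o _ = (fun n => nu (\bigcup_n A n) - nu (D n))); last exact/funext.
  by rewrite -[X in _ --> X]subr0; apply: cvgB => //; exact: cvg_cst.
pose nuC : {charge set T -> \bar R} :=
  HB.pack nu' (isCharge.Build _ _ _ nu' nu'0 nu'fin nu'sig).
have nuCP : nuC `<< P.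
  by apply/null_content_dominatesP => A mA PA; rewrite /= /nu' nuP.
have Lf := Radon_Nikodym_integrable nuCP.
pose y w := fine (Radon_Nikodym nuC P w).
have yE : EFin \o y = Radon_Nikodym nuC P.
  by apply/funext => w; rewrite /= /y fineK//; exact: Radon_Nikodym_fin_num.
have Ly : L1 y by rewrite yE.
exists y => // A mA.
rewrite (_ : (fun w => _) = y \_ A); last first.
  by apply/funext => w; rewrite indicE patchE; case: (_ \in _); rewrite ?mul1r ?mul0r.
rewrite -Rintegral_mkcond /Rintegral.
have := Radon_Nikodym_integral nuCP mA; rewrite -yE /comp => <-.
by [].
Qed.

End density.

(** * Order continuous homomorphisms *)

Section order_continuous_homomorphisms.
Context d (T : measurableType d) (R : realType) (P : probability T R).
Variables (F : set (set T)) (sF : sub_sigma_field F).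
Variables (phi : R -> \bar R) (yphi : young_function phi).
Variables (mu : (T -> R) -> T -> R).

Notation L1 f := (P.-integrable [set: T] (EFin \o f)).
Notation E f := (Rintegral P [set: T] f).
Notation Lphi := (orlicz_module P F phi).

Hypothesis hmu : module_hom P F Lphi mu.

Lemma hom_wrt x : Lphi x -> measurable_wrt F (mu x).
Proof. by case: hmu => _ + _ _; apply. Qed.

Lemma hom_measurable x : Lphi x -> measurable_fun [set: T] (mu x).
Proof. by move=> Lx; exact: measurable_wrtW (hom_wrt Lx). Qed.

Lemma hom_add x x' : Lphi x -> Lphi x' ->
  ae_eq P [set: T] (mu (fun w => x w + x' w)) (fun w => mu x w + mu x' w).
Proof. by case: hmu => _ _ + _; apply. Qed.

Lemma hom_mul (eta x : T -> R) : measurable_wrt F eta -> Lphi x ->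
  ae_eq P [set: T] (mu (fun w => eta w * x w)) (fun w => eta w * mu x w).
Proof. by case: hmu => _ _ _; apply. Qed.

Lemma hom_sub x x' : Lphi x -> Lphi x' ->
  ae_eq P [set: T] (mu (fun w => x w - x' w)) (fun w => mu x w - mu x' w).
Proof.
move=> Lx Lx'; have mN : measurable_wrt F (cst (-1) : T -> R) by exact: measurable_cst.
have LN := orlicz_mul sF (young_gauge yphi) Lx' mN.
apply: filterS2 (hom_add Lx LN) (hom_mul mN Lx') => w /(_ I) e /(_ I) e' _.
rewrite -[in RHS]mulN1r -[X in _ + X]e' -e; congr (mu _ w).
by apply/funext => v; rewrite mulN1r.
Qed.

Section sigma_order.
Hypothesis soc : sigma_order_continuous P Lphi mu.

(* If [`|mu (x_ n)|] exceeded [eps] infinitely often on a set [B], then gluing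
   the [x_ n] along the [F]-measurable random times at which this happens would
   yield a sequence decreasing to 0 with images bounded below by [eps] on [B]. *)
Lemma hom_eventually_le (x_ : nat -> T -> R) (eps : R) : 0 < eps ->
  (forall n, Lphi (x_ n)) ->
  {ae P, forall w, nonincreasing_seq (x_ ^~ w) /\ x_ n w @[n --> \oo] --> 0} ->
  {ae P, forall w, exists k, forall n, (k <= n)%N -> `|mu (x_ n) w| <= eps}.
Proof.
move=> eps0 Lx cx; have x0 := decreasing_between cx.
(* Emptying the sets with [n < k] forces the index chosen at stage [k] to be at least [k] on [B]. *)
pose A k n := if (k <= n)%N then [set w | eps < `|mu (x_ n) w|] else set0.
have mA k n : measurable (A k n : set (g_sigma_algebraType F)).
  rewrite /A; case: ifP => _ //.
  apply: (@measurable_ltr_set _ (g_sigma_algebraType F) _ (cst eps)) => //.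
  by apply: measurableT_comp => //; exact: hom_wrt.
have /choice [N NP] := fun k => first_index_measurable (mA k).
pose B := \bigcap_k \bigcup_n A k n.
have FB : F B.
  apply/(measurable_sub_sigma sF); apply: bigcapT_measurable => k.
  exact: bigcupT_measurable.
have FN k n : F [set w | N k w = n].
  by apply/(measurable_sub_sigma sF); exact: (NP k).1.
have AP k n w : A k n w -> (k <= n)%N /\ eps < `|mu (x_ n) w|.
  by rewrite /A; case: ifP.
have BN k w : B w -> A k (N k w) w.
  by move=> /(_ k I) [n _ Akn]; exact: ((NP k).2 w n Akn).1.
have Nge k w : B w -> (k <= N k w)%N by move=> /(BN k) /AP[].
have Nnd k w : B w -> (N k w <= N k.+1 w)%N.
  move=> /(BN k.+1) /AP[kN eN]; apply: ((NP k).2 w _ _).2.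
  by rewrite /A ltnW.
pose z k w := \1_B w * x_ (N k w) w.
have mB : measurable_fun [set: T] (\1_B : T -> R).
  exact: measurable_indic (sub_sigma_measurable sF FB).
have mz k : measurable_fun [set: T] (z k).
  apply: measurable_funM => //; apply: measurable_select.
    by move=> n; exact: orlicz_measurable (Lx n).
  by move=> n; exact: sub_sigma_measurable (FN k n).
have Lz k : Lphi (z k).
  apply: (orlicz_ideal sF (young_gauge yphi) (Lx 0%N) (mz k)).
  apply: filterS x0 => w x0; have /andP[a b] := x0 (N k w).
  have /andP[c _] := x0 0%N; rewrite normrM !ger0_norm// indicE.
  by case: (_ \in _); rewrite ?mul1r ?mul0r.
have cz : {ae P, forall w, nonincreasing_seq (z ^~ w) /\ z n w @[n --> \oo] --> 0}.
  apply: filterS2 x0 cx => w x0 [nd cw]; have [Bw|nBw] := pselect (B w); last first.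
    rewrite (_ : z ^~ w = cst 0); first by split => //; exact: cvg_cst.
    by apply/funext => k; rewrite /z indicE memNset// mul0r.
  have zE k : z k w = x_ (N k w) w by rewrite /z indicE mem_set// mul1r.
  split.
    apply/nonincreasing_seqP => k; rewrite !zE; apply: nd; exact: Nnd.
  apply: (squeeze_cvgr _ (cvg_cst 0) cw); apply: nearW => k.
  by rewrite zE (andP (x0 _)).1 nd// Nge.
(* On [[N k = n]] intersected with [B], a set of [F], [z k] and [x_ n] coincide; as [mu] commutes
   with the indicator, so do their images. There are countably many [n], so a.e. this may be read at
   [n = N k w]. *)
have zle k : {ae P, forall w, ((eps * \1_B w)%:E <= `|mu (z k) w|%:E)%E}.
  have : {ae P, forall w n, \1_([set w | N k w = n] `&` B) w * mu (z k) w =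
      \1_([set w | N k w = n] `&` B) w * mu (x_ n) w}.
    apply/ae_foralln => n.
    have mI : measurable_wrt F (\1_([set w | N k w = n] `&` B) : T -> R).
      apply: measurable_wrt_indic => //; apply/(measurable_sub_sigma sF).
      by apply: measurableI; apply/(measurable_sub_sigma sF).
    apply: filterS2 (hom_mul mI (Lz k)) (hom_mul mI (Lx n)) => w /(_ I) <- /(_ I) <-.
    congr (mu _ w); apply/funext => v; rewrite /z !indicE in_setI.
    case: (boolP (v \in [set w | N k w = n])) => [|_]; last by rewrite !mul0r.
    by rewrite inE /= => ->; case: (v \in B); rewrite /= ?mul1r ?mul0r.
  move=> glue; apply: (@filterS _ _ (ae_filter_ringOfSetsType P) _ _ _ glue) => w.
  move=> /(_ (N k w)); rewrite lee_fin !indicE in_setI.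
  have -> : w \in [set w' | N k w' = N k w] by rewrite inE.
  have [wB|wB] := boolP (w \in B); last by rewrite mulr0.
  by rewrite !mul1r mulr1 => ->; move: wB; rewrite inE => /(BN k) /AP[_ /ltW].
have [_ _ inf] := soc Lz cz.
have mh : measurable_fun [set: T] (fun w => (eps * \1_B w)%:E).
  by apply/measurable_EFinP; exact: measurable_funM.
have := inf _ mh zle; apply: filterS => w.
rewrite lee_fin indicE; have [|] := boolP (w \in B).
  by rewrite mulr1 leNgt eps0.
rewrite notin_setE => nB _; apply: contrapT => nle; apply: nB => k _.
apply: contrapT => nU; apply: nle; exists k => n kn; rewrite leNgt; apply/negP => lt.
by apply: nU; exists n => //; rewrite /A kn.
Qed.

Lemma hom_cvg0 (x_ : nat -> T -> R) : (forall n, Lphi (x_ n)) ->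
  {ae P, forall w, nonincreasing_seq (x_ ^~ w) /\ x_ n w @[n --> \oo] --> 0} ->
  {ae P, forall w, mu (x_ n) w @[n --> \oo] --> 0}.
Proof.
move=> Lx cx.
have : {ae P, forall w j, exists k, forall n, (k <= n)%N ->
    `|mu (x_ n) w| <= j.+1%:R^-1}.
  by apply/ae_foralln => j; apply: hom_eventually_le.
apply: filterS => w H; apply/cvgr0Pnorm_le => e e0.
have [k ek] : exists k : nat, k.+1%:R^-1 < e.
  by exists (Num.truncn e^-1); rewrite invf_plt ?posrE// truncnS_gt.
have [m Hm] := H k; exists m => // n /= mn.
exact: le_trans (Hm n mn) (ltW ek).
Qed.

End sigma_order.

(** Order boundedness is applied to the order interval from [-|x|] to [|x|]; its damping will
    provide the dominating constant 1 in the limits below. *)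
Lemma hom_bound x : order_bounded P F Lphi mu -> Lphi x ->
  exists b : T -> R, measurable_wrt F b /\
    forall z, Lphi z -> {ae P, forall w, `|z w| <= `|x w|} ->
      {ae P, forall w, `|mu z w| <= b w}.
Proof.
move=> ob Lx; have mx := orlicz_measurable Lx; have g := young_gauge yphi.
have mnx : measurable_fun [set: T] (fun w => `|x w|) by exact: measurableT_comp.
have [|_ [a [b [Fa Fb ab]]]] :=
    ob [set z | Lphi z /\ {ae P, forall w, `|z w| <= `|x w|}].
  split; first by move=> z [].
  exists (fun w => - `|x w|), (fun w => `|x w|); split.
  - apply: (orlicz_ideal sF g Lx); first exact: measurableT_comp.
    by apply: aeW => w; rewrite normrN normr_id.
  - apply: (orlicz_ideal sF g Lx) => //.
    by apply: aeW => w; rewrite normr_id.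
  - by move=> z [_]; apply: filterS => w; rewrite ler_norml.
exists (fun w => `|a w| + `|b w|); split.
  by apply: measurable_funD; exact: measurableT_comp.
move=> z Lz zx; have /ab : (mu @` [set z | Lphi z /\
    {ae P, forall w, `|z w| <= `|x w|}]) (mu z) by exists z.
apply: filterS => w /andP[aw bw]; rewrite ler_norml.
have := ler_norm (- a w); have := ler_norm (b w); rewrite normrN.
by have := normr_ge0 (a w); have := normr_ge0 (b w); lra.
Qed.

End order_continuous_homomorphisms.

(** * Representing the homomorphism by an integrable density *)

Section representation.
Context d (T : measurableType d) (R : realType) (P : probability T R).
Variables (F : set (set T)) (sF : sub_sigma_field F).
Variables (phi : R -> \bar R) (yphi : young_function phi).
Variables (mu : (T -> R) -> T -> R).

Notation L1 f := (P.-integrable [set: T] (EFin \o f)).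
Notation E f := (Rintegral P [set: T] f).
Notation Lphi := (orlicz_module P F phi).

Hypotheses (hmu : module_hom P F Lphi mu).
Hypotheses (soc : sigma_order_continuous P Lphi mu).
Hypotheses (ob : order_bounded P F Lphi mu).

Let unit_Lphi z : unit_valued z -> Lphi z.
Proof.
move=> [mz z01]; apply: (orlicz_bounded P sF (c := 1) yphi mz) => w.
by have := z01 w => /andP[? ?]; rewrite ger0_norm.
Qed.

Lemma unit_valued_indic (A : set T) : measurable A -> unit_valued (\1_A : T -> R).
Proof.
move=> mA; split; first exact: measurable_indic.
by move=> w; rewrite indicE; case: (_ \in _); rewrite ?lexx ?ler01.
Qed.

(** Here [1_A] is a.e. equal to [0 * 1_A], which [mu] sends to 0 by homogeneity. *)
Lemma hom_null (A : set T) : measurable A -> P A = 0%E ->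
  ae_eq P [set: T] (mu \1_A) (cst 0).
Proof.
move=> mA PA; have LA := unit_Lphi (unit_valued_indic mA).
have m0 : measurable_wrt F (cst 0 : T -> R) by exact: measurable_cst.
have L0A := orlicz_mul sF (young_gauge yphi) LA m0.
have e : ae_eq P [set: T] \1_A (fun w => cst 0 w * \1_A w : R).
  exists A; split => // w /= nA; apply: contrapT => Aw; apply: nA => _.
  by rewrite indicE memNset// mul0r.
case: hmu => /(_ _ _ LA L0A e) e1 _ _ _.
apply: filterS2 e1 (hom_mul hmu m0 LA) => w /(_ I) -> /(_ I) -> _.
by rewrite mul0r.
Qed.

(** The bound [b] of [mu] on the order interval of the constant 1 gives [|rho mu z| <= 1] for all
    [0,1]-valued [z] at once. This makes the set function [nu] finite and supplies the domination
    for its continuity. *)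
Lemma hom_density : exists b y : T -> R, [/\ measurable_wrt F b, L1 y &
  forall z, unit_valued z -> L1 (fun w => damping b w * mu z w) /\
    E (fun w => damping b w * mu z w) = E (fun w => z w * y w)].
Proof.
have u1 : unit_valued (cst 1 : T -> R).
  by split; [exact: measurable_cst|move=> w; rewrite /= ler01 lexx].
have [b [Fb bP]] := hom_bound sF yphi ob (unit_Lphi u1).
have wr := weight_damping Fb; set rho := damping b in wr.
have mr := unit_wrt_measurable sF (weight_unit wr).
have dom z : unit_valued z -> {ae P, forall w, `|rho w * mu z w| <= 1}.
  move=> uz; have : {ae P, forall w, `|mu z w| <= b w}.
    apply: bP; first exact: unit_Lphi.
    by apply: aeW => w; have /andP[z0 z1] := uz.2 w; rewrite normr1 ger0_norm.
  apply: filterS => w le; apply: le_trans (damping_le1 b w).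
  by rewrite !normrM ler_wpM2l// (le_trans le)// ler_norm.
have mz z : unit_valued z -> measurable_fun [set: T] (fun w => rho w * mu z w).
  by move=> uz; apply: measurable_funM => //; exact: (hom_measurable sF hmu (unit_Lphi uz)).
have Lz z : unit_valued z -> L1 (fun w => rho w * mu z w).
  by move=> uz; exact: L1_le_ae (mz z uz) (L1_cst P 1) (dom z uz).
pose nu (A : set T) := E (fun w => rho w * mu \1_A w).
have [A B mA mB AB0|A mA ndA A0|A mA PA|y Ly yE] := @set_function_density _ _ R P nu.
- have uA := unit_valued_indic mA; have uB := unit_valued_indic mB.
  rewrite /nu -(E_D (Lz _ uA) (Lz _ uB)); apply: E_ae_eq.
  + exact: (mz _ (unit_valued_indic (measurableU _ _ mA mB))).
  + by apply: measurable_funD; exact: mz.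
  + apply: filterS (hom_add hmu (unit_Lphi uA) (unit_Lphi uB)) => w /(_ I) e _.
    rewrite -mulrDr -e; congr (_ * mu _ w); apply/funext => v.
    rewrite !indicE in_setU; case: (boolP (v \in A)); case: (boolP (v \in B));
      rewrite /= ?addr0 ?add0r// !inE => Bv Av.
    by have : (A `&` B) v by []; rewrite AB0.
- have uA n := unit_valued_indic (mA n).
  have c0 : {ae P, forall w, mu \1_(A n) w @[n --> \oo] --> 0}.
    apply: (hom_cvg0 sF yphi hmu soc (x_ := fun n => \1_(A n))).
      by move=> n; exact: unit_Lphi.
    apply: aeW => w; split.
      apply/nonincreasing_seqP => n; rewrite !indicE ler_nat.
      by case: (boolP (w \in A n.+1)) => //; rewrite inE => /ndA Anw; rewrite mem_set.
    have [k nAk] : exists k, ~ A k w.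
      apply: contrapT => nA; have : (\bigcap_n A n) w; last by rewrite A0.
      by move=> k _; apply: contrapT => nAk; apply: nA; exists k.
    apply: cvg_near_cst; exists k => // n /= kn; rewrite indicE memNset// => Anw.
    apply: nAk; rewrite -(subnK kn) in Anw.
    by elim: (n - k)%N Anw => //= m IH /ndA.
  have [_] : L1 (cst 0 : T -> R) /\
      nu (A n) @[n --> \oo] --> E (cst 0 : T -> R).
    apply: E_dominated (L1_cst P 1) _.
    + by move=> n; exact: mz.
    + exact: measurable_cst.
    + by apply: filterS c0 => w cw; rewrite -(mulr0 (rho w)); exact: cvgMr.
    + by move=> n; exact: dom.
  by rewrite E_cst.
- have uA := unit_valued_indic mA; rewrite /nu -(E_cst P 0); apply: E_ae_eq.
  + exact: mz.
  + exact: measurable_cst.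
  + by apply: filterS (hom_null mA PA) => w /(_ I) -> _; rewrite mulr0.
exists b, y; split => // z uz; split; first exact: Lz.
have Lzy v : unit_valued v -> L1 (fun w => v w * y w).
  move=> [mv v01]; apply: L1_mul => // w.
  by have /andP[v0 v1] := v01 w; rewrite ger0_norm.
pose D v := E (fun w => rho w * mu v w) - E (fun w => v w * y w).
apply/eqP; rewrite -subr_eq0; apply/eqP.
(* The constant bounds the two terms of [D] separately: [|rho mu v| <= 1] a.e., and
   [|v y| <= |y|]. *)
apply: (@halving_vanish _ _ _ D (1 + E (fun w => `|y w|))) => //.
- by move=> A mA; rewrite /D yE// subrr.
- move=> v v' uv uv'.
  have m2 : measurable_wrt F (cst (2^-1) : T -> R) by exact: measurable_cst.
  have Lvv : Lphi (fun w => v w + v' w).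
    apply: (orlicz_bounded P sF (c := 2) yphi).
      exact: measurable_funD uv.1 uv'.1.
    move=> w; have := uv.2 w; have := uv'.2 w => /andP[? ?] /andP[? ?].
    by rewrite ger0_norm; lra.
  have um : unit_valued (fun w => (v w + v' w) / 2).
    split; last by move=> w; have := uv.2 w; have := uv'.2 w; lra.
    apply: measurable_funM; last exact: measurable_cst.
    exact: measurable_funD uv.1 uv'.1.
  rewrite /D.
  have -> : E (fun w => rho w * mu (fun w => (v w + v' w) / 2) w) =
      2^-1 * (E (fun w => rho w * mu v w) + E (fun w => rho w * mu v' w)).
    rewrite -(E_D (Lz _ uv) (Lz _ uv')) -(E_Z _ (L1_D (Lz _ uv) (Lz _ uv'))).
    apply: E_ae_eq; first exact: mz.
      exact: (L1_measurable (L1_Z 2^-1 (L1_D (Lz _ uv) (Lz _ uv')))).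
    apply: filterS2 (hom_mul hmu m2 Lvv) (hom_add hmu (unit_Lphi uv) (unit_Lphi uv')).
    move=> w /(_ I) e /(_ I) e' _; rewrite e' in e.
    rewrite (_ : (fun w => (v w + v' w) / 2) = (fun w => cst 2^-1 w * (v w + v' w))).
      by rewrite e -mulrDr mulrCA.
    by apply/funext => x; rewrite mulrC.
  have -> : E (fun w => (v w + v' w) / 2 * y w) =
      2^-1 * (E (fun w => v w * y w) + E (fun w => v' w * y w)).
    rewrite -(E_D (Lzy _ uv) (Lzy _ uv')) -(E_Z _ (L1_D (Lzy _ uv) (Lzy _ uv'))).
    by congr Rintegral; apply/funext => w; lra.
  lra.
- move=> v uv; apply: le_trans (ler_normB _ _) _; apply: lerD.
    apply: le_trans (E_norm (Lz _ uv)) _; rewrite -[leRHS](E_cst P).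
    by apply: E_le_ae; [exact/L1_norm/Lz|exact: L1_cst|exact: dom].
  apply: le_trans (E_norm (Lzy _ uv)) _.
  apply: E_le; [exact: L1_norm (Lzy _ uv)|exact: L1_norm|].
  by move=> w; have /andP[v0 v1] := uv.2 w; rewrite normrM ler_piMl// ger0_norm.
Qed.

Section density_extension.
Variables (rho y : T -> R) (wr : weight F rho) (Ly : L1 y).
Hypothesis hom_unit : forall z, unit_valued z -> L1 (fun w => rho w * mu z w) /\
    E (fun w => rho w * mu z w) = E (fun w => z w * y w).

Let mr := unit_wrt_measurable sF (weight_unit wr).

(** Being [F]-measurable, the test function [k] and the factor [1/c] pass through [mu]; they are
    moved into the argument, where [k u / c] is [0,1]-valued. *)
Lemma hom_density_bounded (u k : T -> R) (c : R) : 0 < c ->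
  measurable_fun [set: T] u -> (forall w, 0 <= u w <= c) -> unit_wrt F k ->
  E (fun w => k w * (rho w * mu u w)) = E (fun w => k w * (u w * y w)).
Proof.
move=> c0 mu' uc uk; pose v w := c^-1 * k w * u w.
have mk := unit_wrt_measurable sF uk.
have mck : measurable_wrt F (fun w => c^-1 * k w).
  by apply: measurable_funM; [exact: measurable_cst|exact: uk.1].
have uv : unit_valued v.
  split; first by do 2 (apply: measurable_funM => //).
  move=> w; have /andP[k0 k1] := uk.2 w; have /andP[u0 u1] := uc w.
  have ci : 0 <= c^-1 by rewrite invr_ge0 ltW.
  rewrite /v mulr_ge0 ?mulr_ge0//= -mulrA mulrC ler_pdivrMr// mul1r.
  by apply: le_trans u1; rewrite ler_piMl.
have Lu : Lphi u.
  by apply: (orlicz_bounded P sF (c := c) yphi) => // w; have /andP[? ?] := uc w; rewrite ger0_norm.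
have [Lv vE] := hom_unit uv.
have e : ae_eq P [set: T] (fun w => c * (rho w * mu v w)) (fun w => k w * (rho w * mu u w)).
  apply: filterS (hom_mul hmu mck Lu) => w /(_ I); rewrite -/v => -> _.
  by field; rewrite gt_eqF.
have mmu := hom_measurable sF hmu Lu.
rewrite -(E_ae_eq (L1_measurable (L1_Z c Lv)) _ e); last first.
  by do 2 (apply: measurable_funM => //).
have Lvy : L1 (fun w => v w * y w).
  apply: L1_mul => //; first exact: uv.1.
  by move=> w; have /andP[? ?] := uv.2 w; rewrite ger0_norm.
rewrite (E_Z _ Lv) vE -(E_Z _ Lvy); congr Rintegral; apply/funext => w.
by rewrite /v; field; rewrite gt_eqF.
Qed.

Lemma min_nat_cvg (r : R) : Num.min r n%:R @[n --> \oo] --> r.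
Proof.
apply: cvg_near_cst; near=> n; apply/min_idPl.
by near: n; exact: nbhs_infty_ger.
Unshelve. all: by end_near. Qed.

(** Both sides are limits over the truncations [min(z, n)]. On the side of [mu] the damping of [b]
    dominates by 1; on the side of [y] integrability is not known beforehand and has to be extracted
    from those same bounds. *)
Lemma hom_density_dominated (x b z : T -> R) : Lphi x -> measurable_wrt F b ->
  (forall z, Lphi z -> {ae P, forall w, `|z w| <= `|x w|} ->
     {ae P, forall w, `|mu z w| <= b w}) ->
  measurable_fun [set: T] z -> (forall w, 0 <= z w <= `|x w|) ->
  [/\ L1 (fun w => damping b w * (z w * y w)),
      L1 (fun w => damping b w * (rho w * mu z w)) &
      forall k, unit_wrt F k ->
        E (fun w => k w * (damping b w * (rho w * mu z w))) =
        E (fun w => k w * (damping b w * (z w * y w)))].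
Proof.
move=> Lx Fb bP mz zx; pose h := damping b.
have uh := weight_unit (weight_damping Fb); rewrite -/h in uh.
have mh := unit_wrt_measurable sF uh.
have my := L1_measurable Ly.
have Lbelow (v : T -> R) : measurable_fun [set: T] v -> (forall w, 0 <= v w <= z w) -> Lphi v.
  move=> mv vz; apply: (orlicz_ideal sF (young_gauge yphi) Lx mv); apply: aeW => w.
  have /andP[z0 zxw] := zx w; have /andP[v0 vzw] := vz w.
  by rewrite ger0_norm// (le_trans vzw).
have mhr (v : T -> R) : Lphi v -> measurable_fun [set: T] (fun w => h w * (rho w * mu v w)).
  move=> Lv; apply: measurable_funM => //; apply: measurable_funM => //.
  exact: (hom_measurable sF hmu Lv).
have dom (v : T -> R) : measurable_fun [set: T] v -> (forall w, 0 <= v w <= z w) ->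
    {ae P, forall w, `|h w * (rho w * mu v w)| <= 1}.
  move=> mv vz; have : {ae P, forall w, `|mu v w| <= b w}.
    apply: bP; first exact: Lbelow.
    apply: aeW => w; have /andP[z0 zxw] := zx w; have /andP[v0 vzw] := vz w.
    by rewrite ger0_norm// (le_trans vzw).
  apply: filterS => w le; apply: le_trans (damping_le1 b w).
  rewrite !normrM ler_wpM2l//; apply: (@le_trans _ _ `|mu v w|).
    by rewrite ler_piMl// (unit_wrt_norm w (weight_unit wr)).
  by rewrite (le_trans le)// ler_norm.
have Lhr (v : T -> R) : measurable_fun [set: T] v -> (forall w, 0 <= v w <= z w) ->
    L1 (fun w => h w * (rho w * mu v w)).
  by move=> mv vz; exact: L1_le_ae (mhr _ (Lbelow v mv vz)) (L1_cst P 1) (dom v mv vz).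
pose u n w := Num.min (z w) n%:R.
have mu_ n : measurable_fun [set: T] (u n).
  by apply: measurable_minr => //; exact: measurable_cst.
have u0z n w : 0 <= u n w <= z w.
  by have /andP[z0 _] := zx w; rewrite /u le_min z0 ler0n ge_min lexx.
have un n w : 0 <= u n w <= n.+1%:R.
  have /andP[-> _] := u0z n w; rewrite /u ge_min; apply/orP; right.
  by rewrite ler_nat.
have Lb (v : T -> R) n : measurable_fun [set: T] v -> (forall w, 0 <= v w <= n.+1%:R) ->
    L1 (fun w => h w * (v w * y w)).
  move=> mv vn; apply: (L1_unit_mul sF uh).
  apply: (L1_le _ (L1_Z n.+1%:R (L1_norm Ly))); first exact: measurable_funM.
  by move=> w; have /andP[v0 vnw] := vn w; rewrite normrM ger0_norm// ler_wpM2r.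
have bound (v : T -> R) n : measurable_fun [set: T] v -> (forall w, 0 <= v w <= u n w) ->
    `|E (fun w => h w * (v w * y w))| <= 1.
  move=> mv vu.
  have vz w : 0 <= v w <= z w.
    by have /andP[-> a] := vu w; have /andP[_ b'] := u0z n w; rewrite (le_trans a).
  have vn w : 0 <= v w <= n.+1%:R.
    by have /andP[-> a] := vu w; have /andP[_ b'] := un n w; rewrite (le_trans a).
  rewrite -(hom_density_bounded _ mv vn uh)//.
  apply: le_trans (E_norm (Lhr v mv vz)) _; rewrite -[leRHS](E_cst P).
  by apply: E_le_ae; [exact: L1_norm (Lhr v mv vz)|exact: L1_cst|exact: dom].
have mC : measurable [set w | cst 0 w <= y w] by exact: measurable_ler_set.
set C := [set w | _] in mC.
(* The truncation is split at the sign of [y]. Each half has a signed pairing with [y] bounded by 1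
   through [mu], so the pairing with [|y|] is at most 2 for every [n], and monotone convergence
   applies. *)
have Labs : L1 (fun w => h w * (z w * `|y w|)).
  apply: (@L1_nondecreasing _ _ _ _ (fun n w => h w * (u n w * `|y w|)) _ 2).
  - move=> n; apply: measurable_funM => //; apply: measurable_funM => //.
    exact: measurableT_comp.
  - apply: measurable_funM => //; apply: measurable_funM => //.
    exact: measurableT_comp.
  - move=> n w; have /andP[? _] := uh.2 w; have /andP[? _] := un n w.
    by rewrite mulr_ge0// mulr_ge0.
  - move=> w m n mn /=; have /andP[? _] := uh.2 w; apply: ler_wpM2l => //; apply: ler_wpM2r => //.
    by rewrite /u le_min2 ?ler_nat.
  - move=> w; apply: cvgMr; apply: cvgMl; exact: min_nat_cvg.
  - move=> n; have := L1_norm (Lb _ n (mu_ n) (un n)).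
    congr (P.-integrable _ (_ \o _)); apply/funext => w.
    have /andP[h0 _] := uh.2 w; have /andP[u0 _] := un n w.
    by rewrite !normrM (ger0_norm h0) (ger0_norm u0).
  - move=> n.
    pose v1 w := \1_C w * u n w; pose v2 w := (1 - \1_C w) * u n w.
    have m1C : measurable_fun [set: T] (\1_C : T -> R) by exact: measurable_indic.
    have mv1 : measurable_fun [set: T] v1 by exact: measurable_funM.
    have mv2 : measurable_fun [set: T] v2.
      by apply: measurable_funM => //; exact: measurable_funB.
    have v1u w : 0 <= v1 w <= u n w.
      have /andP[? _] := un n w; rewrite /v1 indicE.
      by case: (_ \in _); rewrite ?mul1r ?mul0r ?lexx ?andbT.
    have v2u w : 0 <= v2 w <= u n w.
      have /andP[? _] := un n w; rewrite /v2 indicE.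
      by case: (_ \in _); rewrite ?subrr ?subr0 ?mul1r ?mul0r ?lexx ?andbT.
    have le w v : 0 <= v <= u n w -> 0 <= v <= n.+1%:R.
      by move=> /andP[-> a]; have /andP[_ b'] := un n w; rewrite (le_trans a).
    rewrite (_ : (fun w => _) =
      (fun w => h w * (v1 w * y w) - h w * (v2 w * y w))); last first.
      apply/funext => w; rewrite -mulrBr -mulrBl /v1 /v2 indicE; congr (_ * _).
      case: (boolP (w \in C)); rewrite ?inE ?notin_setE /C /= => yw.
        by rewrite ger0_norm//; lra.
      by rewrite ltr0_norm ?ltNge; [lra|exact/negP].
    rewrite (E_B (Lb _ n mv1 (fun w => le w _ (v1u w))) (Lb _ n mv2 (fun w => le w _ (v2u w)))).
    have := bound v1 n mv1 v1u; have := bound v2 n mv2 v2u.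
    by rewrite !ler_norml; lra.
have Lzy : L1 (fun w => h w * (z w * y w)).
  apply: (L1_le _ Labs).
    by apply: measurable_funM => //; exact: measurable_funM.
  move=> w; have /andP[h0 _] := uh.2 w; have /andP[z0 _] := zx w.
  by rewrite !normrM (ger0_norm h0) (ger0_norm z0).
have zz w : 0 <= z w <= z w by have /andP[-> _] := zx w; rewrite lexx.
have Lhz := Lhr z mz zz; split => // k uk; rewrite -/h.
have mk := unit_wrt_measurable sF uk.
have cmu : {ae P, forall w, mu (u n) w @[n --> \oo] --> mu z w}.
  have Lu n : Lphi (u n) by exact: Lbelow.
  have Lz : Lphi z by exact: Lbelow.
  have Ld n : Lphi (fun w => z w - u n w).
    apply: Lbelow; first exact: measurable_funB.
    by move=> w; have /andP[? ?] := u0z n w; lra.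
  (* The differences [z - min(z, n)] decrease to 0, the only kind of convergence to which [hom_cvg0]
     applies. *)
  have c0 : {ae P, forall w, mu (fun w => z w - u n w) w @[n --> \oo] --> 0}.
    apply: (hom_cvg0 sF yphi hmu soc (x_ := fun n w => z w - u n w)) => //.
    apply: aeW => w; split.
      by move=> m n mn; rewrite lerB// /u le_min2// ler_nat.
    by rewrite -(subrr (z w)); apply: cvgB; [exact: cvg_cst|exact: min_nat_cvg].
  have eq : {ae P, forall w n, mu (fun w => z w - u n w) w = mu z w - mu (u n) w}.
    apply/ae_foralln => n.
    by apply: filterS (hom_sub sF yphi hmu Lz (Lu n)) => w /(_ I).
  apply: filterS2 c0 eq => w c0 eq.
  rewrite (_ : (fun n => _) = (fun n => mu z w - mu (fun w => z w - u n w) w)).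
    by rewrite -[X in _ --> X]subr0; apply: cvgB => //; exact: cvg_cst.
  by apply/funext => n; rewrite eq subKr.
have Lhu n := Lhr (u n) (mu_ n) (u0z n).
have [_ c1] : L1 (fun w => k w * (h w * (rho w * mu z w))) /\
    E (fun w => k w * (h w * (rho w * mu (u n) w))) @[n --> \oo] -->
    E (fun w => k w * (h w * (rho w * mu z w))).
  apply: E_dominated (L1_cst P 1) _.
  - by move=> n; exact: L1_measurable (L1_unit_mul sF uk (Lhu n)).
  - exact: L1_measurable (L1_unit_mul sF uk Lhz).
  - by apply: filterS cmu => w cw; do 3 apply: cvgMr.
  - move=> n; apply: filterS (dom (u n) (mu_ n) (u0z n)) => w le; rewrite normrM.
    by apply: mulr_ile1 => //; exact: unit_wrt_norm uk.
have Luy n := Lb (u n) n (mu_ n) (un n).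
have [_ c2] : L1 (fun w => k w * (h w * (z w * y w))) /\
    E (fun w => k w * (h w * (u n w * y w))) @[n --> \oo] -->
    E (fun w => k w * (h w * (z w * y w))).
  apply: E_dominated Labs _.
  - by move=> n; exact: L1_measurable (L1_unit_mul sF uk (Luy n)).
  - exact: L1_measurable (L1_unit_mul sF uk Lzy).
  - by apply: aeW => w; apply: cvgMr; apply: cvgMr; apply: cvgMl; exact: min_nat_cvg.
  - move=> n; apply: aeW => w; have /andP[h0 _] := uh.2 w.
    have /andP[un0 uz] := u0z n w; have /andP[z0 _] := zz w.
    apply: (@le_trans _ _ `|h w * (u n w * y w)|).
      by rewrite normrM ler_piMl//; exact: unit_wrt_norm uk.
    rewrite !normrM (ger0_norm h0) (ger0_norm un0).
    by apply: ler_wpM2l => //; exact: ler_wpM2r.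
rewrite -(cvg_lim _ c1)// -(cvg_lim _ c2)//; congr (limn _); apply/funext => n.
have := hom_density_bounded (ltr0Sn _ n) (mu_ n) (un n) (unit_wrtM uk uh).
by under eq_Rintegral do rewrite -mulrA; under [RHS]eq_Rintegral do rewrite -mulrA.
Qed.

End density_extension.

(** [y] is a density of [rho mu], and [e = 1 / rho] restores [mu]. The factors are kept apart
    because [y] is integrable, as the duality argument demands, while [e y] need not be. *)
Lemma hom_representation : exists e y : T -> R,
  [/\ measurable_wrt F e, L1 y,
      forall x, Lphi x -> exists2 h, weight F h & L1 (fun w => h w * (x w * y w)) &
      represents P F Lphi mu (fun w => e w * y w)].
Proof.
have [c [y [Fc Ly hom_unit]]] := hom_density.
have wr := weight_damping Fc; set rho := damping c in hom_unit wr.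
have mr := unit_wrt_measurable sF (weight_unit wr).
have my := L1_measurable Ly.
have main x : Lphi x -> exists h : T -> R, [/\ weight F h, L1 (fun w => h w * (x w * y w)),
    L1 (fun w => h w * (rho w * mu x w)) & forall k, unit_wrt F k ->
    E (fun w => k w * (h w * (rho w * mu x w))) = E (fun w => k w * (h w * (x w * y w)))].
  move=> Lx; have mx := orlicz_measurable Lx.
  have [b [Fb bP]] := hom_bound sF yphi ob Lx; pose h := damping b.
  have wh := weight_damping Fb; rewrite -/h in wh.
  pose xp w := Num.max (x w) 0; pose xn w := Num.max (- x w) 0.
  have mxp : measurable_fun [set: T] xp by exact: measurable_maxr.
  have mxn : measurable_fun [set: T] xn.
    by apply: measurable_maxr => //; exact: measurableT_comp.
  have xpx w : 0 <= xp w <= `|x w|.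
    by rewrite /xp le_max lexx orbT ge_max ler_norm normr_ge0.
  have xnx w : 0 <= xn w <= `|x w|.
    by rewrite /xn le_max lexx orbT ge_max normr_ge0 -normrN ler_norm.
  have xE w : x w = xp w - xn w.
    by rewrite /xp /xn /Num.max; case: ltP => ?; case: ltP => ?; lra.
  have Lpart (v : T -> R) : measurable_fun [set: T] v -> (forall w, 0 <= v w <= `|x w|) -> Lphi v.
    move=> mv vx; apply: (orlicz_ideal sF (young_gauge yphi) Lx mv).
    by apply: aeW => w; have /andP[v0 ?] := vx w; rewrite ger0_norm.
  have Lp := Lpart xp mxp xpx; have Ln := Lpart xn mxn xnx.
  have [Lp1 Lp2 pE] := hom_density_dominated wr Ly hom_unit Lx Fb bP mxp xpx.
  have [Ln1 Ln2 nE] := hom_density_dominated wr Ly hom_unit Lx Fb bP mxn xnx.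
  rewrite -/h in Lp1 Lp2 pE Ln1 Ln2 nE.
  have xy : (fun w => h w * (x w * y w)) =
      (fun w => h w * (xp w * y w) - h w * (xn w * y w)).
    by apply/funext => w; rewrite -mulrBr -mulrBl -xE.
  have emu : ae_eq P [set: T] (fun w => h w * (rho w * mu xp w) - h w * (rho w * mu xn w))
      (fun w => h w * (rho w * mu x w)).
    apply: filterS (hom_sub sF yphi hmu Lp Ln) => w /(_ I) e _.
    rewrite -!mulrBr -e; congr (_ * (_ * mu _ w)).
    by apply/funext => v; rewrite xE.
  have mhx : measurable_fun [set: T] (fun w => h w * (rho w * mu x w)).
    apply: measurable_funM; first exact: unit_wrt_measurable sF _ (weight_unit wh).
    by apply: measurable_funM => //; exact: (hom_measurable sF hmu Lx).
  have Lhx := L1_ae_eq mhx emu (L1_B Lp2 Ln2).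
  have Lhxy : L1 (fun w => h w * (x w * y w)) by rewrite xy; exact: L1_B.
  exists h; split => // k uk.
  transitivity (E (fun w => k w * (h w * (rho w * mu xp w)) - k w * (h w * (rho w * mu xn w)))).
    have Ld := L1_B (L1_unit_mul sF uk Lp2) (L1_unit_mul sF uk Ln2).
    apply: E_ae_eq.
    - exact: L1_measurable (L1_unit_mul sF uk Lhx).
    - exact: L1_measurable Ld.
    - by apply: filterS emu => w /(_ I) e _; rewrite -e mulrBr.
  rewrite (E_B (L1_unit_mul sF uk Lp2) (L1_unit_mul sF uk Ln2)) pE// nE//.
  rewrite -(E_B (L1_unit_mul sF uk Lp1) (L1_unit_mul sF uk Ln1)).
  by congr Rintegral; apply/funext => w; rewrite -!mulrBr -mulrBl -xE.
pose e w := 1 + `|c w|.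
have me : measurable_wrt F e.
  apply: measurable_funD; first exact: measurable_cst.
  exact: measurableT_comp.
have rK w : rho w * e w = 1.
  by rewrite mulVf// gt_eqF// ltr_pwDl.
exists e, y; split => //.
  by move=> x /main[h [wh Lh _ _]]; exists h.
move=> x Lx; have [h [wh Lh Lh' hE]] := main x Lx.
have mx := orlicz_measurable Lx.
have mey : measurable_fun [set: T] (fun w => e w * y w).
  by apply: measurable_funM => //; exact: measurable_wrtW me.
(* As [rho e = 1], testing [x (e y)] with the weight [h rho] is testing [x y] with [h]. *)
have e1 : (fun w => h w * rho w * (x w * (e w * y w))) =
    (fun w => h w * (x w * y w)).
  by apply/funext => w; rewrite [x w * _]mulrCA -!mulrA [rho w * _]mulrA rK mul1r.
have e2 : (fun w => h w * rho w * mu x w) = (fun w => h w * (rho w * mu x w)).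
  by apply/funext => w; rewrite mulrA.
have := gcondexp_unique sF (measurable_funM mx mey) (weightM wh wr) _ (hom_wrt hmu Lx).
rewrite e1 e2 => /(_ _ Lh Lh') ge.
have {}ge : ae_eq P [set: T] (gcondexp P F (EFin \o (fun w => x w * (e w * y w))))
    (EFin \o mu x).
  apply: ge => k uk; rewrite (_ : (fun w => k w * (h w * rho w * mu x w)) =
      (fun w => k w * (h w * (rho w * mu x w)))); last first.
    by apply/funext => w; ring.
  rewrite hE//; congr Rintegral; apply/funext => w.
  by rewrite -(congr1 (@^~ w) e1).
by apply: filterS ge => w /(_ I) g _; rewrite -g.
Qed.

End representation.

(** * The Koethe dual of an Orlicz module *)

Section conjugate_approximation.
Context (R : realType) (phi : R -> \bar R) (yphi : young_function phi).

Notation p r := (fine (phi r)).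

(** An enumeration of the nonnegative rationals at which [phi] is finite; all other codes give 0,
    harmless because [phi 0 = 0]. Countably many nodes allow near maximizers to be chosen
    measurably. *)
Definition conjugate_node (i : nat) : R :=
  if unpickle i is Some r then
    if (0 <= r :> rat) && (phi (ratr r) < +oo)%E then ratr r else 0
  else 0.

Lemma conjugate_node_ge0 i : 0 <= conjugate_node i.
Proof.
rewrite /conjugate_node; case: unpickle => // r; case: ifP => // /andP[r0 _].
by rewrite ler0q.
Qed.

Lemma young_finE r : 0 <= r -> (phi r < +oo)%E -> ((p r)%:E = phi r)%E.
Proof. by move=> r0 rfin; rewrite fineK// ge0_fin_numE// (young_ge0 yphi). Qed.

Lemma conjugate_node_lty i : (phi (conjugate_node i) < +oo)%E.
Proof.
rewrite /conjugate_node; case: unpickle => [r|]; last by rewrite (young0 yphi).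
by case: ifP => [/andP[]|] //; rewrite (young0 yphi).
Qed.

(* [conjugate_argmax m s] maximizes [q * s - phi q] over the first [m] nodes,
   so that [conjugate_max m] increases to the conjugate. *)
Fixpoint conjugate_argmax (m : nat) (s : R) : R :=
  if m is n.+1 then
    let q := conjugate_node n in let x := conjugate_argmax n s in
    if x * s - p x < q * s - p q then q else x
  else 0.

Definition conjugate_max m s :=
  conjugate_argmax m s * s - p (conjugate_argmax m s).

Lemma conjugate_argmax_ge0 m s : 0 <= conjugate_argmax m s.
Proof.
by elim: m => //= m IH; case: ifP => // _; exact: conjugate_node_ge0.
Qed.

Lemma conjugate_argmax_lty m s : (phi (conjugate_argmax m s) < +oo)%E.
Proof.
elim: m => /= [|m IH]; first by rewrite (young0 yphi).
by case: ifP => // _; exact: conjugate_node_lty.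
Qed.

(** Only finitely many nodes compete at level [m], so the bound is uniform in [s]; it makes the near
    maximizers and their [phi]-values bounded random variables. *)
Lemma conjugate_argmax_bounded m : exists c, forall s,
  conjugate_argmax m s <= c /\ p (conjugate_argmax m s) <= c.
Proof.
elim: m => [|m [c IH]] /=; first by exists 0 => s; rewrite (young0 yphi).
pose q := conjugate_node m; exists (Num.max c (Num.max q (p q))) => s.
have [h1 h2] := IH s; case: ifP => _; rewrite !le_max ?lexx ?orbT//.
by rewrite h1 h2.
Qed.

Lemma conjugate_max_nd s : nondecreasing_seq (conjugate_max ^~ s).
Proof.
apply/nondecreasing_seqP => m; rewrite /conjugate_max /=.
by case: ltP => [/ltW|].
Qed.

Lemma conjugate_max_ge0 m s : 0 <= conjugate_max m s.
Proof.
apply: le_trans (conjugate_max_nd s (leq0n m)).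
by rewrite /conjugate_max /= (young0 yphi) mul0r subr0.
Qed.

Lemma conjugate_max_node i s :
  conjugate_node i * s - p (conjugate_node i) <= conjugate_max i.+1 s.
Proof. by rewrite /conjugate_max /=; case: ltP. Qed.

(** Rational nodes exhaust the supremum: a rational [q] slightly below [r] satisfies
    [phi q <= phi r] and loses only [(r - q) s]. *)
Lemma conjugate_max_cvg s : 0 <= s ->
  ((conjugate_max m s)%:E @[m --> \oo] --> young_conjugate phi s)%E.
Proof.
move=> s0; have nd : {homo (fun m => (conjugate_max m s)%:E) : m n /
    (m <= n)%N >-> (m <= n)%E}.
  by move=> m n mn; rewrite lee_fin conjugate_max_nd.
suff -> : young_conjugate phi s =
    ereal_sup (range (fun m => (conjugate_max m s)%:E)).
  exact: ereal_nondecreasing_cvgn.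
apply/eqP; rewrite eq_le; apply/andP; split; last first.
  apply: ge_ereal_sup => _ [m _ <-]; apply: ereal_sup_ubound.
  exists (conjugate_argmax m s).
    by rewrite /= in_itv /= conjugate_argmax_ge0.
  by rewrite -young_finE ?conjugate_argmax_ge0 ?conjugate_argmax_lty.
apply: ge_ereal_sup => _ [r /= + <-]; rewrite in_itv /= andbT => r0.
set S := ereal_sup _.
have S0 m : ((conjugate_max m s)%:E <= S)%E by apply: ereal_sup_ubound; exists m.
have [rfin|] := ltP (phi r) +oo%E; last first.
  by rewrite leye_eq => /eqP ->; rewrite leNye.
rewrite -(young_finE r0 rfin) -EFinB; apply/lee_addgt0Pr => e e0.
have [->|rn0] := eqVneq r 0.
  rewrite mul0r (young0 yphi) sub0r oppr0.
  apply: (@le_trans _ _ S); last by rewrite leeDl// lee_fin ltW.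
  by apply: le_trans (S0 0%N); rewrite lee_fin conjugate_max_ge0.
have rgt0 : 0 < r by rewrite lt_def rn0.
(* Dividing [e] by [s + 1] instead of [s] also covers [s = 0]. *)
have [t [t0 tr te]] : exists t, [/\ 0 <= t, t < r & (r - t) * s <= e].
  have se : 0 < s + 1 by rewrite ltr_pwDr.
  exists (Num.max 0 (r - e / (s + 1))); split; first by rewrite le_max lexx.
    by rewrite gt_max rgt0 /= ltrBlDr ltrDl divr_gt0.
  apply: (@le_trans _ _ (e / (s + 1) * s)).
    by rewrite ler_wpM2r// lerBlDl -lerBlDr le_max lexx orbT.
  by rewrite mulrAC ler_pdivrMr// ler_pM2l// lerDl.
have [q] := rat_in_itvoo tr; rewrite in_itv /= => /andP[tq qr].
have q0 : 0 <= ratr q :> R by rewrite (le_trans t0)// ltW.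
have qfin : (phi (ratr q) < +oo)%E.
  by apply: le_lt_trans rfin; apply: (young_nondecreasing yphi) => //; exact: ltW.
have nq : conjugate_node (pickle q) = ratr q.
  by rewrite /conjugate_node pickleK qfin -(ler0q R) q0.
have := conjugate_max_node (pickle q) s; rewrite nq => le.
apply: (@le_trans _ _ ((conjugate_max (pickle q).+1 s)%:E + e%:E)%E); last first.
  by rewrite leeD2r.
rewrite -EFinD lee_fin.
have pq : p (ratr q) <= p r.
  rewrite -lee_fin !young_finE//.
  by apply: (young_nondecreasing yphi) => //; exact: ltW.
have : (r - ratr q) * s <= (r - t) * s by apply: ler_wpM2r => //; lra.
lra.
Qed.

Lemma measurable_young_fine : measurable_fun [set: R] (fun r => p `|r|).
Proof. exact: (measurableT_comp _ (gauge_measurable (young_gauge yphi))). Qed.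

Lemma measurable_conjugate_argmax m : measurable_fun [set: R] (conjugate_argmax m).
Proof.
elim: m => [|m IH].
  by rewrite (_ : conjugate_argmax 0 = cst 0)//; exact: measurable_cst.
rewrite (_ : conjugate_argmax m.+1 = fun s =>
    let q := conjugate_node m in let x := conjugate_argmax m s in
    if x * s - p x < q * s - p q then q else x)//=.
apply: measurable_fun_ifT => //.
have e : (fun s => p (conjugate_argmax m s)) = (fun s => p `|conjugate_argmax m s|).
  by apply/funext => s; rewrite ger0_norm// conjugate_argmax_ge0.
apply: measurable_fun_ltr.
  apply: measurable_funB; first exact: measurable_funM.
  by rewrite e; exact: (measurableT_comp measurable_young_fine IH).
apply: measurable_funB; last exact: measurable_cst.
by apply: measurable_funM => //; exact: measurable_cst.
Qed.

End conjugate_approximation.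

(** * Dyadic series in an Orlicz module *)

Section series.
Context d (T : measurableType d) (R : realType) (P : probability T R).
Variables (F : set (set T)) (sF : sub_sigma_field F).
Variables (phi : R -> \bar R) (yphi : young_function phi).

Lemma nondecreasing_le_limn (u : nat -> \bar R) n :
  {homo u : m n / (m <= n)%N >-> (m <= n)%E} -> (u n <= limn u)%E.
Proof.
move=> nd; rewrite (cvg_lim _ (ereal_nondecreasing_cvgn nd))//.
by apply: ereal_sup_ubound; exists n.
Qed.

(** The fibres of [N] form a countable partition; on each of them a random index is frozen, and
    conditional estimates with a fixed index apply. *)
Lemma fiber_integral_le (N : T -> nat) (f f' : T -> \bar R) :
  (forall n, measurable [set w | N w = n]) ->
  measurable_fun [set: T] f -> (forall w, 0 <= f w)%E ->
  measurable_fun [set: T] f' -> (forall w, 0 <= f' w)%E ->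
  (forall n, \int[P]_w ((\1_[set w | N w = n] w)%:E * f w) <=
             \int[P]_w ((\1_[set w | N w = n] w)%:E * f' w))%E ->
  (\int[P]_w f w <= \int[P]_w f' w)%E.
Proof.
move=> mN mf f0 mf' f0' ff'.
have UN : \bigcup_n [set w | N w = n] = [set: T].
  by apply/seteqP; split => // w _; exists (N w).
have tN : trivIset setT (fun n => [set w | N w = n]).
  by apply/trivIsetP => i j _ _ ij; apply/seteqP; split => // w [/= -> e]; rewrite e eqxx in ij.
have fib (g : T -> \bar R) : measurable_fun [set: T] g -> (forall w, 0 <= g w)%E ->
    (\int[P]_w g w = \sum_(n <oo) \int[P]_w ((\1_[set w | N w = n] w)%:E * g w))%E.
  move=> mg g0; rewrite -[in LHS]UN ge0_integral_bigcup//; last first.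
    by apply: measurable_funS mg.
  apply: eq_eseriesr => n _; rewrite integral_mkcond; apply: eq_integral => w _.
  by rewrite patchE indicE; case: (_ \in _); rewrite ?mul1e ?mul0e.
rewrite fib// [leRHS]fib//; apply: lee_nneseries => [n _ _|n _]; last exact: ff'.
by apply: integral_ge0 => w _; rewrite mule_ge0// lee_fin indicE; case: (_ \in _).
Qed.

Definition dyadic_sum (u : nat -> T -> R) n w : R :=
  \sum_(k < n) 2^-1 ^+ k.+1 * u k w.

Lemma dyadic_sumS u n w :
  dyadic_sum u n.+1 w = dyadic_sum u n w + 2^-1 ^+ n.+1 * u n w.
Proof. by rewrite /dyadic_sum big_ord_recr. Qed.

(** The sum is the midpoint of the first term and of the sum for the shifted sequence, so convexity
    between two points carries an induction on [n]. *)
Lemma dyadic_sum_recl u n w : dyadic_sum u n.+1 w =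
  2^-1 * u 0%N w + 2^-1 * dyadic_sum (fun k => u k.+1) n w.
Proof.
rewrite /dyadic_sum big_ord_recl expr1 big_distrr /=; congr (_ + _).
by apply: eq_bigr => i _; rewrite mulrA -exprS.
Qed.

Lemma measurable_dyadic_sum u n : (forall k, measurable_fun [set: T] (u k)) ->
  measurable_fun [set: T] (dyadic_sum u n).
Proof.
move=> mu; elim: n => [|n IH].
  rewrite (_ : dyadic_sum u 0 = cst 0); first exact: measurable_cst.
  by apply/funext => w; rewrite /dyadic_sum big_ord0.
rewrite (_ : dyadic_sum u n.+1 = fun w => dyadic_sum u n w + 2^-1 ^+ n.+1 * u n w).
  by apply: measurable_funD => //; apply: measurable_funM => //; exact: measurable_cst.
by apply/funext => w; rewrite dyadic_sumS.
Qed.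

Lemma dyadic_sum_ge0 u n w : (forall k w, 0 <= u k w) -> 0 <= dyadic_sum u n w.
Proof. by move=> u0; apply: sumr_ge0 => k _; rewrite mulr_ge0// exprn_ge0. Qed.

Lemma dyadic_sum_nd u w : (forall k w, 0 <= u k w) ->
  nondecreasing_seq (dyadic_sum u ^~ w).
Proof.
move=> u0; apply/nondecreasing_seqP => n.
by rewrite dyadic_sumS lerDl mulr_ge0// exprn_ge0.
Qed.

Let gphi := young_gauge yphi.

Lemma dyadic_sum_modular (u : nat -> T -> R) n :
  (forall k, measurable_fun [set: T] (u k)) -> (forall k w, 0 <= u k w) ->
  (forall k, \int[P]_w phi `|u k w|%R <= 1)%E ->
  (\int[P]_w phi `|dyadic_sum u n w|%R <= 1)%E.
Proof.
elim: n u => [|n IH] u mu u0 u1.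
  rewrite integral0_eq ?lee01// => w _.
  by rewrite /dyadic_sum big_ord0 normr0 (young0 yphi).
pose v k := u k.+1.
have half0 : (0 <= 2^-1 :> R)%R by rewrite invr_ge0.
have mphi (x : T -> R) : measurable_fun [set: T] x ->
    measurable_fun [set: T] (fun w => (2^-1)%:E * phi `|x w|%R)%E.
  by move=> mx; apply: measurable_funeM; exact: gauge_comp_measurable.
have phi0 (x : T -> R) w : (0 <= (2^-1)%:E * phi `|x w|%R)%E.
  by apply: mule_ge0; rewrite ?lee_fin//; exact: (gauge_ge0 gphi).
have mv : measurable_fun [set: T] (dyadic_sum v n).
  by apply: measurable_dyadic_sum => k; exact: mu.
apply: (@le_trans _ _ (\int[P]_w ((2^-1)%:E * phi `|u 0%N w|%R +
    (2^-1)%:E * phi `|dyadic_sum v n w|%R))%E).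
  apply: ge0_le_integral => //.
  - by move=> w _; exact: (gauge_ge0 gphi).
  - exact/(gauge_comp_measurable gphi)/measurable_dyadic_sum.
  - by apply: emeasurable_funD; exact: mphi.
  - move=> w _; rewrite !ger0_norm ?dyadic_sum_ge0//; last by move=> ? ?; exact: u0.
    rewrite dyadic_sum_recl.
    have := young_convex yphi (u0 0%N w) (dyadic_sum_ge0 n w (u := v) (fun k => u0 k.+1))
      (_ : 0 <= 2^-1 <= 1).
    have -> : (1 - 2^-1 = 2^-1 :> R) by lra.
    by apply; lra.
rewrite (ge0_integralD P measurableT (fun w _ => phi0 (u 0%N) w) (mphi _ (mu 0%N))
  (fun w _ => phi0 (dyadic_sum v n) w) (mphi _ mv)).
have -> : (1 = (2^-1)%:E * 1 + (2^-1)%:E * 1 :> \bar R)%E.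
  by rewrite !mule1 -EFinD; congr EFin; lra.
have scale (x : T -> R) : measurable_fun [set: T] x ->
    (\int[P]_w phi `|x w|%R <= 1)%E ->
    (\int[P]_w ((2^-1)%:E * phi `|x w|%R) <= (2^-1)%:E * 1)%E.
  move=> mx x1; rewrite ge0_integralZl_EFin//.
  - by apply: lee_wpmul2l; rewrite ?lee_fin.
  - by move=> w _; exact: (gauge_ge0 gphi).
  - exact: gauge_comp_measurable.
by apply: leeD; apply: scale => //; apply: IH => k *; [exact: mu|exact: u0|exact: u1].
Qed.

(** The increasing limit [f] of [phi (s n)] has integral at most 1, hence is a.e. finite; where it
    is finite, growth of [phi] bounds the partial sums, and their limit [S] is real. *)
Lemma dyadic_series_orlicz (u : nat -> T -> R) :
  (forall k, measurable_fun [set: T] (u k)) -> (forall k w, 0 <= u k w) ->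
  (forall k, \int[P]_w phi `|u k w|%R <= 1)%E ->
  exists2 S, orlicz_module P F phi S &
    {ae P, forall w n, dyadic_sum u n w <= S w}.
Proof.
move=> mu u0 u1; pose s n w := dyadic_sum u n w.
have ms n : measurable_fun [set: T] (s n) by exact: measurable_dyadic_sum.
have s0 n w : 0 <= s n w by exact: dyadic_sum_ge0.
have nds w : nondecreasing_seq (s ^~ w) by exact: dyadic_sum_nd.
pose f_ n w := phi `|s n w|%R.
have mf_ n : measurable_fun [set: T] (f_ n) by exact: gauge_comp_measurable.
have f_0 n w : (0 <= f_ n w)%E by exact: (gauge_ge0 gphi).
have ndf w : {homo f_ ^~ w : m n / (m <= n)%N >-> (m <= n)%E}.
  move=> m n mn; apply: (gauge_nd gphi) => //.
  by rewrite !ger0_norm//; exact: nds.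
pose f w : \bar R := limn (f_ ^~ w).
have cf w : f_ n w @[n --> \oo] --> f w by exact: ereal_nondecreasing_is_cvgn.
have f_f n w : (f_ n w <= f w)%E.
  exact: nondecreasing_le_limn (ndf w).
have mf : measurable_fun [set: T] f.
  by apply: (@emeasurable_fun_cvg _ _ _ _ f_) => // w _; exact: cf.
have f0 w : (0 <= f w)%E by apply: le_trans (f_f 0%N w).
have intf : (\int[P]_w f w <= 1)%E.
  have cI : (\int[P]_w f_ n w @[n --> \oo] --> \int[P]_w f w)%E.
    exact: monotone_integral_cvg.
  rewrite -(cvg_lim _ cI)//; apply: lime_le; first by apply/cvg_ex; eexists; exact: cI.
  by apply: nearW => n; exact: dyadic_sum_modular.
have ffin : {ae P, forall w, (f w < +oo)%E}.
  have If : P.-integrable [set: T] f.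
    apply/integrableP; split => //.
    under eq_integral do rewrite gee0_abs//.
    by apply: le_lt_trans intf _; exact: ltry.
  apply: filterS (integrable_ae measurableT If) => w /(_ I).
  by rewrite ge0_fin_numE.
pose G w : \bar R := limn (fun n => (s n w)%:E).
have ndE w : {homo (fun n => (s n w)%:E) : m n / (m <= n)%N >-> (m <= n)%E}.
  by move=> m n mn; rewrite lee_fin; exact: nds.
have cG w : (s n w)%:E @[n --> \oo] --> G w by exact: ereal_nondecreasing_is_cvgn.
have s_G n w : ((s n w)%:E <= G w)%E.
  exact: (nondecreasing_le_limn n (ndE w)).
have mG : measurable_fun [set: T] G.
  apply: (@emeasurable_fun_cvg _ _ _ _ (fun n w => (s n w)%:E)) => //.
  by move=> n; exact/measurable_EFinP.
pose S w := fine (G w).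
have mS : measurable_fun [set: T] S by exact: measurableT_comp.
have Sfin : {ae P, forall w, (S w)%:E = G w}.
  apply: filterS ffin => w; have := f0 w; case fw : (f w) => [r||] // _ _.
  have [M [_ HM]] := cvgey_gt (young_pinfty yphi) r.
  have sM n : s n w <= M.
    rewrite leNgt; apply/negP => /HM lt.
    have := f_f n w; rewrite fw /f_ ger0_norm//.
    by move=> /(lt_le_trans lt); rewrite ltxx.
  rewrite fineK// ge0_fin_numE; last by apply: le_trans (s_G 0%N w); rewrite lee_fin.
  apply: (@le_lt_trans _ _ M%:E); last exact: ltry.
  apply: lime_le; first by apply/cvg_ex; eexists; exact: cG.
  by apply: nearW => n; rewrite lee_fin.
exists S; last first.
  by apply: filterS Sfin => w Sw n; rewrite -lee_fin Sw; exact: s_G.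
apply/(orlicz_moduleP P sF gphi); split => //.
(* Where [S > 0], [S / 2] lies strictly below the supremum of the partial sums, so some [s n]
   exceeds it and [phi(S / 2) <= f]. *)
exists (cst 2^-1); first by split; [exact: measurable_cst|move=> w /=; lra].
have mS2 : measurable_fun [set: T] (fun w => cst 2^-1 w * S w).
  by apply: measurable_funM => //; exact: measurable_cst.
apply: (@le_lt_trans _ _ (\int[P]_w f w)%E); last exact: le_lt_trans intf (ltry _).
apply: ae_ge0_le_integral => //.
- by move=> w _; exact: (gauge_ge0 gphi).
- exact: gauge_comp_measurable.
apply: filterS Sfin => w Sw _.
have S0 : 0 <= S w by rewrite -lee_fin Sw; apply: le_trans (s_G 0%N w); rewrite lee_fin.
rewrite /= ger0_norm ?mulr_ge0//; have [->|Sn0] := eqVneq (S w) 0.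
  by rewrite mulr0 (young0 yphi).
have Sgt0 : 0 < S w by rewrite lt_def Sn0.
have [n sn] : exists n, 2^-1 * S w <= s n w.
  apply: contrapT => /forallNP ns.
  have : (G w <= (2^-1 * S w)%:E)%E.
    apply: lime_le; first by apply/cvg_ex; eexists; exact: cG.
    by apply: nearW => n; rewrite lee_fin leNgt; apply/negP => /ltW; exact: ns.
  by rewrite -Sw lee_fin; lra.
apply: le_trans (f_f n w); rewrite /f_ ger0_norm//.
by apply: (gauge_nd gphi) => //; rewrite mulr_ge0.
Qed.

End series.

(** * Membership in the conjugate module *)

Section koethe_dual.
Context d (T : measurableType d) (R : realType) (P : probability T R).
Variables (F : set (set T)) (sF : sub_sigma_field F).
Variables (phi : R -> \bar R) (yphi : young_function phi).

Notation L1 f := (P.-integrable [set: T] (EFin \o f)).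
Notation E f := (Rintegral P [set: T] f).
Notation Lphi := (orlicz_module P F phi).

Lemma condexp_real_ge0 f : L1 f -> (forall w, 0 <= f w) ->
  exists g : T -> R, [/\ measurable_wrt F g, L1 g, forall w, 0 <= g w &
    forall h, unit_wrt F h -> E (fun w => h w * g w) = E (fun w => h w * f w)].
Proof.
move=> Lf f0; have [g [mg Lg gE _]] := condexp_real sF Lf.
have L0 : L1 (cst 0 : T -> R) by exact: L1_cst.
have m0 : measurable_wrt F (cst 0 : T -> R) by exact: measurable_cst.
have g0 : {ae P, forall w, 0 <= g w}.
  apply: (wrt_le_ae sF m0 mg L0 Lg) => h uh; rewrite gE//.
  apply: E_le; [exact: (L1_unit_mul sF uh L0)|exact: (L1_unit_mul sF uh Lf)|].
  by move=> w; apply: ler_wpM2l => //; case/andP: (uh.2 w).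
pose g' w := Num.max (g w) 0.
have mg' : measurable_wrt F g' by exact: measurable_maxr mg m0.
have gg' : ae_eq P [set: T] g g'.
  by apply: filterS g0 => w g0 _; exact/esym/max_idPl.
have Lg' := L1_ae_eq (measurable_wrtW sF mg') gg' Lg.
exists g'; split => // [w|h uh]; first by rewrite /g' le_max lexx orbT.
rewrite -gE//; apply: E_ae_eq.
- exact: L1_measurable (L1_unit_mul sF uh Lg').
- exact: L1_measurable (L1_unit_mul sF uh Lg).
- by apply: filterS gg' => w /(_ I) ->.
Qed.

Lemma integral_indic_EFin (A : set T) (f : T -> R) : L1 (fun w => \1_A w * f w) ->
  (\int[P]_w ((\1_A w)%:E * (f w)%:E) = (E (fun w => \1_A w * f w))%:E)%E.
Proof. by move=> L; rewrite E_fin. Qed.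

(** [B] collects the points where, for every [k], some approximation [v k m] of [phi^*(2^-k |y|)]
    has conditional expectation at least 1. The series shows that [B] is null; off [B], some [k]
    keeps all these conditional expectations below 1, and 2^-k for the first such [k] is the
    required weight. *)
Lemma koethe_dual (y : T -> R) : L1 y ->
  (forall x, Lphi x -> exists2 h, weight F h & L1 (fun w => h w * (x w * y w))) ->
  orlicz_module P F (young_conjugate phi) y.
Proof.
move=> Ly koethe; have my := L1_measurable Ly.
have gphi := young_gauge yphi; have gconj := conjugate_gauge yphi.
have half0 k : 0 <= 2^-1 ^+ k :> R by rewrite exprn_ge0// invr_ge0.
pose s k w := 2^-1 ^+ k * `|y w|.
pose x k m w := conjugate_argmax phi m (s k w).
pose p k m w := fine (phi (x k m w)).
pose v k m w := conjugate_max phi m (s k w).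
have s0 k w : 0 <= s k w by rewrite mulr_ge0.
have Ls k : L1 (s k) by exact: L1_Z (L1_norm Ly).
have ms k := L1_measurable (Ls k).
have x0 k m w : 0 <= x k m w by exact: conjugate_argmax_ge0.
have mx k m : measurable_fun [set: T] (x k m).
  exact: (measurableT_comp (measurable_conjugate_argmax yphi m) (ms k)).
have phi_x k m w : ((p k m w)%:E = phi (x k m w))%E.
  by apply: young_finE => //; exact: conjugate_argmax_lty.
have p0 k m w : 0 <= p k m w by rewrite fine_ge0// (young_ge0 yphi).
have mp k m : measurable_fun [set: T] (p k m).
  have := measurableT_comp (measurable_young_fine yphi) (mx k m).
  congr measurable_fun; apply/funext => w.
  by rewrite /= ger0_norm.
have Lp k m : L1 (p k m).
  have [b xb] := conjugate_argmax_bounded yphi m.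
  apply: (@L1_bounded _ _ _ _ _ b) => // w; rewrite ger0_norm//.
  by have [_] := xb (s k w).
have Lxs k m : L1 (fun w => x k m w * s k w).
  have [b xb] := conjugate_argmax_bounded yphi m.
  apply: (L1_le _ (L1_Z b (Ls k))); first exact: measurable_funM.
  move=> w; rewrite ger0_norm ?mulr_ge0//.
  by apply: ler_wpM2r => //; have [] := xb (s k w).
have vE k m : v k m = (fun w => x k m w * s k w - p k m w) by [].
have Lv k m : L1 (v k m) by rewrite vE; exact: L1_B.
have v0 k m w : 0 <= v k m w by exact: conjugate_max_ge0.
have /choice [c_ c_P] := fun km : nat * nat => condexp_real_ge0 (Lp km.1 km.2) (p0 km.1 km.2).
have /choice [g_ g_P] := fun km : nat * nat => condexp_real_ge0 (Lv km.1 km.2) (v0 km.1 km.2).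
pose c k m := c_ (k, m); pose g k m := g_ (k, m).
have mc k m : measurable_wrt F (c k m) by have [] := c_P (k, m).
have Lc k m : L1 (c k m) by have [] := c_P (k, m).
have c0 k m w : 0 <= c k m w by have [_ _ + _] := c_P (k, m); apply.
have cE k m h : unit_wrt F h ->
  E (fun w => h w * c k m w) = E (fun w => h w * p k m w) by have [_ _ _] := c_P (k, m); apply.
have mg k m : measurable_wrt F (g k m) by have [] := g_P (k, m).
have Lg k m : L1 (g k m) by have [] := g_P (k, m).
have gE k m h : unit_wrt F h ->
  E (fun w => h w * g k m w) = E (fun w => h w * v k m w) by have [_ _ _] := g_P (k, m); apply.
clearbody c g; clear c_ c_P g_ g_P.
have m1 : measurable_wrt F (cst 1 : T -> R) by exact: measurable_cst.
pose A k m := [set w | 1 <= g k m w].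
have mA k m : measurable (A k m : set (g_sigma_algebraType F)).
  exact: (@measurable_ler_set _ (g_sigma_algebraType F) _ (cst 1) (g k m) m1 (mg k m)).
have /choice [N NP] := fun k => first_index_measurable (mA k).
have FN k n : F [set w | N k w = n].
  by apply/(measurable_sub_sigma sF); exact: (NP k).1.
have mN k n := sub_sigma_measurable sF (FN k n).
pose B := \bigcap_k \bigcup_m A k m.
have FB : F B.
  apply/(measurable_sub_sigma sF); apply: bigcapT_measurable => k.
  exact: bigcupT_measurable.
have uB : unit_wrt F (\1_B : T -> R) by exact: (unit_wrt_indic R sF FB).
have uD k n : unit_wrt F (\1_[set w | N k w = n] : T -> R).
  exact: (unit_wrt_indic R sF (FN k n)).
have BN k w : B w -> 1 <= g k (N k w) w.
  by move=> /(_ k I) [n _ Akn]; exact: ((NP k).2 w n Akn).1.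
(* With [c] the conditional expectation of [phi(x)], the damping [1 / (1 + c)] does two things at
   once: the modular becomes at most [c / (1 + c)], and as [x s = v + phi(x)], the pairing with [s]
   has conditional expectation [(g + c) / (1 + c)], at least 1 where [g >= 1]. *)
pose a k m w := \1_B w * (damping (c k m) w * x k m w).
pose u k w := a k (N k w) w.
have ud k m := weight_unit (weight_damping (mc k m)).
have d0 k m w : 0 <= damping (c k m) w by have /andP[] := (ud k m).2 w.
have ind0 (C : set T) w : 0 <= \1_C w :> R by rewrite indicE; case: (_ \in _).
have u0 k w : 0 <= u k w by rewrite /u /a !mulr_ge0.
have mu k : measurable_fun [set: T] (u k).
  apply: measurable_select => // n; apply: measurable_funM.
    exact: unit_wrt_measurable sF _ uB.
  by apply: measurable_funM => //; exact: unit_wrt_measurable sF _ (ud k n).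
have uE k n w : \1_[set w' | N k w' = n] w * u k w =
    \1_[set w' | N k w' = n] w * a k n w.
  by rewrite indicE; case: (boolP (w \in _)); rewrite ?mul0r// inE /= /u => ->.
have modular k : (\int[P]_w phi `|u k w|%R <= 1)%E.
  have -> : (1 = \int[P]_w (cst 1 w) :> \bar R)%E.
    by rewrite integral_cst//; have /= -> := probability_setT P; rewrite mule1.
  apply: (fiber_integral_le (mN k)) => //.
  - exact: gauge_comp_measurable.
  - by move=> w; exact: (gauge_ge0 gphi).
  move=> n; set D := [set w | _].
  have uDd := unit_wrtM (uD k n) (ud k n); rewrite -/D in uDd.
  have mD : measurable_fun [set: T] (\1_D : T -> R) := unit_wrt_measurable sF (uD k n).
  apply: (@le_trans _ _ (\int[P]_w (\1_D w * damping (c k n) w * p k n w)%:E)%E).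
    apply: ge0_le_integral => //.
    - move=> w _; apply: mule_ge0; first by rewrite lee_fin.
      exact: (gauge_ge0 gphi).
    - apply: emeasurable_funM; first exact/measurable_EFinP.
      exact: gauge_comp_measurable.
    - exact/measurable_EFinP/(L1_measurable (L1_unit_mul sF uDd (Lp k n))).
    move=> w _; rewrite indicE; have [wD|_] := boolP (w \in D); last first.
      by rewrite mul0e mul0r mul0r.
    rewrite mul1e mul1r; move: wD; rewrite inE /D /= => Nw.
    rewrite ger0_norm// /u Nw /a EFinM phi_x mulrA.
    have /andP[b0 b1] := (unit_wrtM uB (ud k n)).2 w.
    apply: le_trans (gauge_scale gphi _ (x0 k n w)) _.
      exact: (unit_wrtM uB (ud k n)).2.
    apply: lee_wpmul2r; first exact: (young_ge0 yphi).
    by rewrite lee_fin ler_piMl//; have /andP[] := uB.2 w.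
  rewrite -(E_fin (L1_unit_mul sF uDd (Lp k n))) -cE//.
  under eq_integral do rewrite mule1.
  have L1D : L1 (\1_D : T -> R).
    apply: (@L1_bounded _ _ _ _ _ 1) => // w.
    by rewrite ger0_norm//; have /andP[] := (uD k n).2 w.
  rewrite -(E_fin L1D) lee_fin; apply: E_le => //.
    exact: (L1_unit_mul sF uDd (Lc k n)).
  move=> w; rewrite -mulrA ler_piMr//.
  by apply: le_trans (ler_norm _) (damping_le1 _ _).
have lower k h : weight F h -> L1 (fun w => h w * (u k w * s k w)) ->
    E (fun w => h w * \1_B w) <= E (fun w => h w * (u k w * s k w)).
  move=> wh Lu; have uh := weight_unit wh.
  have h0 w : 0 <= h w by have /andP[] := uh.2 w.
  have uhB := unit_wrtM uh uB.
  have LhB : L1 (fun w => h w * \1_B w).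
    apply: (@L1_bounded _ _ _ _ _ 1); first exact: unit_wrt_measurable sF _ uhB.
    by move=> w; exact: unit_wrt_norm uhB.
  rewrite -lee_fin !E_fin//; apply: (fiber_integral_le (mN k)).
  - exact/measurable_EFinP/(L1_measurable LhB).
  - by move=> w; rewrite lee_fin mulr_ge0.
  - exact/measurable_EFinP/(L1_measurable Lu).
  - by move=> w; rewrite lee_fin !mulr_ge0.
  move=> n; set D := [set w | _].
  have LD1 := L1_unit_mul sF (uD k n) LhB; have LD2 := L1_unit_mul sF (uD k n) Lu.
  rewrite -/D in LD1 LD2; rewrite !integral_indic_EFin// lee_fin.
  (* All [F]-measurable factors are gathered into one test function, so that [g] and [c] can replace
     [v] and [p]. *)
  pose e w := \1_D w * (h w * (\1_B w * damping (c k n) w)).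
  have ue : unit_wrt F e.
    by apply: unit_wrtM (uD k n) _; apply: unit_wrtM uh _; exact: unit_wrtM.
  have -> : E (fun w => \1_D w * (h w * (u k w * s k w))) =
      E (fun w => e w * (g k n w + c k n w)).
    transitivity (E (fun w => e w * v k n w + e w * p k n w)).
      congr Rintegral; apply/funext => w; rewrite -mulrDr vE subrK.
      transitivity (h w * (\1_D w * u k w) * s k w); first by ring.
      by rewrite uE /e /a -/D; ring.
    rewrite (E_D (L1_unit_mul sF ue (Lv k n)) (L1_unit_mul sF ue (Lp k n))) -gE// -cE//.
    rewrite -(E_D (L1_unit_mul sF ue (Lg k n)) (L1_unit_mul sF ue (Lc k n))).
    by congr Rintegral; apply/funext => w; rewrite mulrDr.
  apply: E_le_ae => //; first exact: (L1_unit_mul sF ue (L1_D (Lg k n) (Lc k n))).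
  apply: aeW => w; rewrite /e !indicE.
  have [wD|_] := boolP (w \in D); last by rewrite !mul0r.
  have [wB|_] := boolP (w \in B); last by rewrite !(mul0r, mulr0).
  rewrite !mul1r mulr1 -mulrA ler_peMr//.
  move: wB wD; rewrite !inE /D /= => /(BN k) g1 Nw; rewrite Nw in g1.
  rewrite /damping ger0_norm// mulrC ler_pdivlMr ?ltr_pwDl//.
  by rewrite mul1r lerD2r.
have [S LS Su] := dyadic_series_orlicz sF yphi mu u0 modular.
have [h wh LhS] := koethe S LS; have uh := weight_unit wh.
have mh := unit_wrt_measurable sF uh.
have h0 w : 0 <= h w by have /andP[] := uh.2 w.
have dS n : {ae P, forall w, `|h w * (dyadic_sum u n w * `|y w|)| <= `|h w * (S w * y w)|}.
  apply: filterS Su => w Su; have d0' : 0 <= dyadic_sum u n w by exact: dyadic_sum_ge0.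
  have S0 : 0 <= S w by exact: le_trans d0' (Su n).
  rewrite !normrM normr_id (ger0_norm d0') (ger0_norm S0).
  by apply: ler_wpM2l => //; apply: ler_wpM2r => //; exact: Su.
have Ld n : L1 (fun w => h w * (dyadic_sum u n w * `|y w|)).
  apply: (L1_le_ae _ (L1_norm LhS) (dS n)).
  apply: measurable_funM => //; apply: measurable_funM; first exact: measurable_dyadic_sum.
  exact: measurableT_comp.
(* Of the coefficient 2^-(k+1), the part 2^-k is the one inside [s k]; only 1/2 remains,
   independently of [k]. *)
have stepE k w : h w * (dyadic_sum u k.+1 w * `|y w|) - h w * (dyadic_sum u k w * `|y w|) =
    2^-1 * (h w * (u k w * s k w)).
  by rewrite dyadic_sumS /s exprS; ring.
have Lus k : L1 (fun w => h w * (u k w * s k w)).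
  have := L1_Z 2 (L1_B (Ld k.+1) (Ld k)).
  congr (P.-integrable _ (_ \o _)); apply/funext => w; rewrite stepE.
  by rewrite mulrA divff ?mul1r// pnatr_eq0.
have growth n : n%:R * (2^-1 * E (fun w => h w * \1_B w)) <=
    E (fun w => h w * (dyadic_sum u n w * `|y w|)).
  elim: n => [|n IH].
    by rewrite mul0r; apply: E_ge0 => w; rewrite !mulr_ge0// dyadic_sum_ge0.
  have step : E (fun w => h w * (dyadic_sum u n.+1 w * `|y w|)) -
      E (fun w => h w * (dyadic_sum u n w * `|y w|)) = 2^-1 * E (fun w => h w * (u n w * s n w)).
    rewrite -(E_B (Ld n.+1) (Ld n)) -(E_Z _ (Lus n)).
    by congr Rintegral; apply/funext => w; exact: stepE.
  have := lower n h wh (Lus n); rewrite -natr1 mulrDl mul1r; lra.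
have hB0 : E (fun w => h w * \1_B w) <= 0.
  rewrite leNgt; apply/negP => pos.
  pose C := E (fun w => `|h w * (S w * y w)|).
  have le n : n%:R * (2^-1 * E (fun w => h w * \1_B w)) <= C.
    apply: le_trans (growth n) _; apply: E_le_ae; [exact: Ld|exact: L1_norm|].
    by apply: filterS (dS n) => w; apply: le_trans; exact: ler_norm.
  pose q := 2^-1 * E (fun w => h w * \1_B w).
  have q0 : 0 < q by rewrite mulr_gt0// invr_gt0.
  have := le (Num.truncn (C / q)).+1; rewrite -/q -ler_pdivlMr// leNgt.
  by rewrite truncnS_gt.
have uhB := unit_wrtM uh uB.
have LhB : L1 (fun w => h w * \1_B w).
  apply: (@L1_bounded _ _ _ _ _ 1); first exact: unit_wrt_measurable sF _ uhB.
  by move=> w; exact: unit_wrt_norm uhB.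
have nB : {ae P, forall w, ~ B w}.
  have := E_eq0 LhB (fun w => (andP (uhB.2 w)).1) hB0.
  apply: filterS => w /(_ I) /= /eqP; rewrite mulf_eq0 gt_eqF ?(weight_gt0 w wh)//=.
  by rewrite indicE pnatr_eq0 eqb0 notin_setE.
pose A' k := \bigcap_m [set w | g k m w < 1].
have mA' k : measurable (A' k : set (g_sigma_algebraType F)).
  apply: bigcapT_measurable => m.
  exact: (@measurable_ltr_set _ (g_sigma_algebraType F) _ (g k m) (cst 1) (mg k m) m1).
(* [K] is the first admissible [k]; its default value is taken only on [B], which is null. *)
have [K [mK KP]] := first_index_measurable mA'.
have FK k : F [set w | K w = k] by apply/(measurable_sub_sigma sF).
have gK : {ae P, forall w m, g (K w) m w < 1}.
  apply: filterS nB => w nB m; have [k A'k] : exists k, A' k w.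
    apply: contrapT => /forallNP nA'; apply: nB => k _.
    apply: contrapT => nU; apply: (nA' k) => m' _ /=.
    by rewrite ltNge; apply/negP => g1; apply: nU; exists m'.
  exact: (KP w k A'k).1.
pose eta w : R := 2^-1 ^+ K w.
have weta : weight F eta.
  split.
    exact: (@measurable_select _ (g_sigma_algebraType F) R (fun k => cst (2^-1 ^+ k)) K
      (fun k => measurable_cst _) mK).
  by move=> w; rewrite /eta exprn_gt0 ?invr_gt0//= exprn_ile1// ?invr_ge0// invf_le1 ?ler1n.
apply/(orlicz_moduleP P sF gconj); split => //; exists eta => //.
apply: (@le_lt_trans _ _ 1%E); last exact: ltry.
(* As [m] grows, [z m] increases to [phi^*(eta |y|)]. On the fibre [[K = k]] it is [v k m], whose
   conditional expectation [g k m] is a.e. below 1 there. *)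
pose z m w := v (K w) m w.
have mz m : measurable_fun [set: T] (EFin \o z m).
  apply/measurable_EFinP.
  exact: (@measurable_select _ _ _ (v ^~ m) K (fun k => L1_measurable (Lv k m))
    (fun k => sub_sigma_measurable sF (FK k))).
have z0 m w : (0 <= (EFin \o z m) w)%E by rewrite lee_fin; exact: v0.
have cz : (\int[P]_w (z m w)%:E @[m --> \oo] -->
    \int[P]_w young_conjugate phi `|eta w * y w|%R)%E.
  apply: (@monotone_integral_cvg _ _ _ P (fun m => EFin \o z m)
    (fun w => young_conjugate phi `|eta w * y w|%R)) => //.
    by move=> w m n mn; rewrite lee_fin; exact: conjugate_max_nd.
  move=> w; rewrite normrM (ger0_norm (half0 _)).
  by apply: conjugate_max_cvg => //; exact: mulr_ge0.
rewrite -(cvg_lim _ cz)//; apply: lime_le; first by apply/cvg_ex; eexists; exact: cz.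
apply: nearW => m.
have -> : (1 = \int[P]_w (cst 1 w) :> \bar R)%E.
  by rewrite integral_cst//; have /= -> := probability_setT P; rewrite mule1.
apply: (@fiber_integral_le _ _ _ P K (EFin \o z m) (cst 1%E)) => //.
- by move=> k; exact: (sub_sigma_measurable sF (FK k)).
move=> k; set D := [set w | _].
have uD' : unit_wrt F (\1_D : T -> R) by exact: (unit_wrt_indic R sF (FK k)).
have mD := unit_wrt_measurable sF uD'.
have L1D : L1 (\1_D : T -> R).
  by apply: (@L1_bounded _ _ _ _ _ 1) => // w; exact: unit_wrt_norm uD'.
have -> : (\int[P]_w ((\1_D w)%:E * (z m w)%:E) = (E (fun w => \1_D w * g k m w))%:E)%E.
  rewrite gE// E_fin; last exact: (L1_unit_mul sF uD' (Lv k m)).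
  apply: eq_integral => w _; rewrite -EFinM; congr EFin.
  by rewrite indicE; case: (boolP (w \in _)); rewrite ?mul0r// inE /D /= /z => ->.
under eq_integral do rewrite mule1.
rewrite -(E_fin L1D) lee_fin; apply: E_le_ae => //.
  exact: (L1_unit_mul sF uD' (Lg k m)).
apply: (@filterS _ _ (ae_filter_ringOfSetsType P) _ _ _ gK) => w /(_ m); rewrite indicE.
case: (boolP (w \in _)); rewrite ?mul0r// inE /D /= => -> g1.
by rewrite mul1r ltW.
Qed.

End koethe_dual.

Theorem theorem4p10 (d : measure_display) (T : measurableType d) (R : realType)
    (P : probability T R) (F : set (set T)) (phi : R -> \bar R)
    (mu : (T -> R) -> (T -> R)) :
  sub_sigma_field F ->
  young_function phi ->
  let Lphi := orlicz_module P F phi in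
  let Lphi_conj := orlicz_module P F (young_conjugate phi) in
  module_hom P F Lphi mu ->
  (sigma_order_continuous P Lphi mu /\ order_bounded P F Lphi mu <->
     exists2 y, Lphi_conj y & represents P F Lphi mu y) /\
  (forall y y', Lphi_conj y -> Lphi_conj y' ->
     represents P F Lphi mu y -> represents P F Lphi mu y' ->
     ae_eq P [set: T] y y').
Proof.
move=> sF yphi Lphi Lconj hmu.
split; last by move=> y y'; exact: represents_unique.
split=> [[soc ob]|[y Ly ry]].
  have [e [y [me Ly koethe rep]]] := hom_representation sF yphi hmu soc ob.
  exists (fun w => e w * y w) => //.
  apply: (orlicz_mul sF (conjugate_gauge yphi) _ me).
  exact: koethe_dual.
have my := orlicz_measurable Ly.
split; first exact: represents_sigma_order_continuous ry Ly.
exact: represents_order_bounded ry Ly.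
Qed.
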